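(* For every $n\in\mathbb{N}$ let $X_n$ be a random variable with values in $\{0,1,2,\dots\}$ and bounded support, and let $\mathcal{G}_n(t)=\mathbb{E}\,t^{X_n}$, which is a polynomial. Suppose that each $\mathcal{G}_n$ has only real (hence, nonpositive) zeros. Suppose further that $(X_n)_{n\in\mathbb{N}}$ converges mod-$\varphi$ with some parameters $(w_n)_{n\in\mathbb{N}}$, $\mathcal{D}$, $\varphi$, $\Psi$. Finally, suppose that $\sup_{n\in\mathbb{N}}\deg(\mathcal{G}_n)/w_n<\infty$. Then the sequence of finite measures on $[0,+\infty)$ $$\mathcal{Z}_n:=\frac{1}{w_n}\sum_{x:\,\mathcal{G}_n(x)=0}\delta_{-x},\qquad n\in\mathbb{N}$$ (the sum is over the zeros of $\mathcal{G}_n$ counted with multiplicities), converges vaguely to a finite measure $\mathcal{Z}$ supported by $[0,+\infty)$ with Stieltjes transform $$\int_{[0,+\infty)}\frac{\mathcal{Z}(dx)}{t-x}=\frac{\varphi'(\log(-t))}{t},\qquad t\in\mathbb{C}\setminus[0,+\infty).$$ In particular, the function $t\mapsto\varphi'(\log(-t))/t$ admits an analytic continuation to $\mathbb{C}\setminus[0,+\infty)$ (and the right-hand side above is understood as this continuation).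
   Context: Mod-$\varphi$ convergence: let $(X_n)$ be real random variables whose Laplace transforms $\mathbb{E}e^{zX_n}$ exist in a strip $\mathcal{H}=\{z\in\mathbb{C}:\operatorname{Re}z\in(\beta_-,\beta_+)\}$, $-\infty\le\beta_-<\beta_+\le+\infty$. The sequence converges mod-$\varphi$ with parameters $(w_n)$, $\mathcal{D}$, $\varphi$, $\Psi$ if: $w_n>0$ and $w_n\to+\infty$; $\mathcal{D}\subset\mathcal{H}$ is open, connected and contains the interval $(\beta_-,\beta_+)$; $\varphi:\mathcal{D}\to\mathbb{C}$ is analytic with real-valued, strictly convex restriction to $(\beta_-,\beta_+)$; $\Psi:\mathcal{D}\to\mathbb{C}$ is analytic and does not vanish on $\mathcal{D}\cap\mathbb{R}$; and $\lim_{n\to\infty}\mathbb{E}e^{zX_n}/e^{w_n\varphi(z)}=\Psi(z)$ uniformly on compact subsets of $\mathcal{D}$. Vague convergence $\nu_n\to\nu$ of finite measures on $\mathbb{R}$ means $\int f\,d\nu_n\to\int f\,d\nu$ for every continuous compactly supported $f:\mathbb{R}\to\mathbb{R}$. The function $\varphi'(\log(-t))/t$ is initially defined for real $t<0$ with $\log(-t)\in(\beta_-,\beta_+)$ and in a complex neighborhood of this set. *)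

(* Defs.v *)
From HB Require Import structures.
From mathcomp Require Import all_boot all_order all_algebra all_real_closed.
From mathcomp Require Import all_classical all_reals all_analysis.
Export numFieldNormedType.Exports.

Set Implicit Arguments.
Unset Strict Implicit.
Unset Printing Implicit Defensive.

Import Order.TTheory GRing.Theory Num.Theory.

Local Open Scope classical_set_scope.
Local Open Scope ring_scope.

(* [R[i]] carries an [R]-module structure, which would clash with the
   [R[i]]-normed module structure needed for complex derivatives. Seen as a
   [numClosedFieldType], it gets the standard topology of a numeric field and
   is a normed module over itself. *)
Definition complexC (R : realType) : numClosedFieldType := R[i].

Section complex_functions.
Context {R : realType}.
Local Notation C := (complexC R).

Definition toC (x : R) : C := x%:C%C.

Definition cexp (z : C) : C :=
  Complex (expR (complex.Re z) * cos (complex.Im z))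
          (expR (complex.Re z) * sin (complex.Im z)).

(* Principal argument, in ]-pi, pi]. *)
Definition carg (z : C) : R :=
  let a := acos (complex.Re z / Normc.normc z) in
  if 0 <= complex.Im z then a else - a.

(* Principal logarithm. *)
Definition clog (z : C) : C := Complex (ln (Normc.normc z)) (carg z).

Definition analytic_on (D : set C) (f : C -> C) :=
  forall z, D z -> derivable f z 1.

(* All the complex zeros of [p], repeated according to their multiplicities. *)
Definition complex_zeros (p : {poly R}) : seq C :=
  sval (closed_field_poly_normal (map_poly toC p)).

Definition only_real_zeros (p : {poly R}) :=
  forall z : C, root (map_poly toC p) z -> complex.Im z = 0.

Definition nonneg_reals : set C := [set toC x | x in `[0, +oo[%classic].

End complex_functions.

Section complex_integral.
Context d (T : measurableType d) {R : realType}.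
Variable mu : {measure set T -> \bar R}.
Local Notation C := (complexC R).

Definition cintegrable (A : set T) (f : T -> C) :=
  mu.-integrable A (fun x => (complex.Re (f x))%:E) /\
  mu.-integrable A (fun x => (complex.Im (f x))%:E).

Definition cintegral (A : set T) (f : T -> C) : C :=
  Complex (\int[mu]_(x in A) complex.Re (f x))
          (\int[mu]_(x in A) complex.Im (f x)).

End complex_integral.

Section mod_phi.
Context {R : realType}.
Local Notation C := (complexC R).

Definition ereal_itv (bm bp : \bar R) : set R :=
  [set x | (bm < x%:E)%E /\ (x%:E < bp)%E].

Definition strip (bm bp : \bar R) : set C :=
  [set z | ereal_itv bm bp (complex.Re z)].

Definition strictly_convex_on (I : set R) (f : R -> R) :=
  forall x y t, I x -> I y -> x != y -> 0 < t -> t < 1 ->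
    f (t * x + (1 - t) * y) < t * f x + (1 - t) * f y.

Definition laplace d (T : measurableType d) (P : probability T R)
    (X : {RV P >-> R}) (z : C) : C :=
  cintegral P setT (fun o => cexp (z * toC (X o))).

Record mod_phi_cvg (d : nat -> measure_display)
    (T : forall n, measurableType (d n)) (P : forall n, probability (T n) R)
    (X : forall n, {RV (P n) >-> R}) (bm bp : \bar R)
    (w : nat -> {posnum R}) (D : set C) (phi Psi : C -> C) : Prop := {
  mod_phi_lt : (bm < bp)%E ;
  mod_phi_laplace : forall n z, strip bm bp z ->
    cintegrable (P n) setT (fun o => cexp (z * toC (X n o))) ;
  mod_phi_w : (w n)%:num @[n --> \oo] --> +oo ;
  mod_phi_sub_strip : D `<=` strip bm bp ;
  mod_phi_open : open D ;
  mod_phi_connected : connected D ;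
  mod_phi_itv : forall x, ereal_itv bm bp x -> D (toC x) ;
  mod_phi_analytic : analytic_on D phi ;
  mod_phi_real : forall x, ereal_itv bm bp x -> complex.Im (phi (toC x)) = 0 ;
  mod_phi_convex :
    strictly_convex_on (ereal_itv bm bp) (fun x => complex.Re (phi (toC x))) ;
  mod_phi_limit_analytic : analytic_on D Psi ;
  mod_phi_limit_neq0 : forall x, D (toC x) -> Psi (toC x) != 0 ;
  mod_phi_limit : forall K, compact K -> K `<=` D ->
    {uniform K, (fun n z =>
        laplace (X n) z / cexp (toC (w n)%:num * phi z)) @ \oo --> Psi} }.

End mod_phi.

Section measures.
Context {R : realType}.
Local Notation C := (complexC R).

(* [1 / w] times the sum, over the zeros [x] of [p] counted with
   multiplicities, of the Dirac masses at [- x]; the zeros are meant to be real,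
   whence the real parts. *)
Definition zeros_measure (w : {posnum R}) (p : {poly R}) : set R -> \bar R :=
  mscale (w%:num^-1)%:nng
    (msum (fun i => \d_(- complex.Re (nth 0 (complex_zeros p) i)))
          (size (complex_zeros p))).

HB.instance Definition _ w p := Measure.on (zeros_measure w p).

Let zeros_measure_fin w p : fin_num_fun (zeros_measure w p).
Proof.
apply: lty_fin_num_fun; rewrite /zeros_measure /mscale/= /msum.
apply: lte_mul_pinfty => //; apply: lte_sum_pinfty => i _.
rewrite ltey_eq fin_num_measure //.
Qed.

HB.instance Definition _ w p :=
  Measure_isFinite.Build _ _ _ (zeros_measure w p) (@zeros_measure_fin w p).

Definition supported_on_nonneg (nu : {finite_measure set R -> \bar R}) :=
  nu `]-oo, 0[%classic = 0%E.

Definition compactly_supported (f : R -> R) :=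
  compact (closure [set x | f x != 0]).

Definition vague_cvg (nu_ : nat -> {finite_measure set R -> \bar R})
    (nu : {finite_measure set R -> \bar R}) :=
  forall f : R -> R, continuous f -> compactly_supported f ->
    \int[nu_ n]_x f x @[n --> \oo] --> \int[nu]_x f x.

Definition stieltjes (nu : {finite_measure set R -> \bar R}) (t : C) : C :=
  cintegral nu `[0, +oo[%classic (fun x => (t - toC x)^-1).

End measures.

(* Main.v *)
(* Writing [-x_1, -x_2, ...] for the zeros of [G n], the modulus
   [|E exp(zX_n)| = |G_n(e^z)|] is a constant times [prod_j |e^z + x_j|], and the
   logarithm of each factor has a second-order Taylor remainder which is uniform
   in [x_j >= 0] wherever [Re e^z > 0]. Dividing by [w_n], mod-phi convergence
   gives [(log |G_n(e^z)|) / w_n -> Re (phi z)]; as the remainders are bounded by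
   [deg G_n / w_n], the gradients converge as well, that is
   [(sum_j e^z / (e^z + x_j)) / w_n -> phi' z]. This is the convergence of the
   Stieltjes transforms of the zero measures at [-e^z], obtained without
   branches of the logarithm and without Cauchy's formula.
   A limit measure is extracted along an ultrafilter from the distribution
   functions. The functions [x |-> 1 / (s + x)], [s] in an interval, span a dense
   subspace of the functions on the half-line that vanish at infinity: difference
   quotients in [s] give the powers of [1 / (s + x)], and Weierstrass'
   theorem does the rest. So convergence of the Stieltjes transforms on an
   interval upgrades to vague convergence of the whole sequence and to convergence
   of the transforms at every point outside the half-line. *)

Require Import Defs.
From HB Require Import structures.
From mathcomp Require Import all_boot all_order all_algebra all_real_closed.
From mathcomp Require Import all_classical all_reals all_analysis.
From mathcomp Require Import measurable_realfun ring lra.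
Set Implicit Arguments.
Unset Strict Implicit.
Unset Printing Implicit Defensive.
Import Order.TTheory GRing.Theory Num.Theory.
Local Open Scope classical_set_scope.
Local Open Scope ring_scope.

(** * Complex arithmetic, limits, exponential and logarithm in real coordinates *)

Section complex_numbers.
Context {R : realType}.
Local Notation C := (complexC R).
Local Notation Re := complex.Re.
Local Notation Im := complex.Im.
Local Notation normc := Normc.normc.
Implicit Types (z w : C) (x y : R).

(** The remainders are uniform in the zeros because [e^z / (e^z + x)] has modulus at most 1 when
    [Re e^z > 0] and [x >= 0]. Only moduli are compared, so each limit shows one real part; moving
    in the directions [1] and ['i] recovers the whole derivative. [Psi] may vanish off the real
    axis, where [log |Psi|] is not finite, hence the restriction to points with [Psi z != 0], which
    include a neighbourhood of every real point of the strip. The masses of the zero measures are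
    bounded but need not converge, since zeros may escape to infinity. Test functions must therefore
    vanish at infinity, as the kernels do. The ultrafilter gives limits of the distribution
    functions at all points at once, without diagonal extraction; since the transforms already
    converge along the whole sequence, their limit has to be the transform of the limit measure. The
    continuation of [phi' (log (-t)) / t] is this transform itself, identified near each admissible
    negative point by uniqueness of limits rather than by an identity theorem. *)

Lemma complexP z w : Re z = Re w -> Im z = Im w -> z = w.
Proof. by case: z w => a b [c d] /= -> ->. Qed.

Lemma ReD z w : Re (z + w) = Re z + Re w. Proof. by case: z w => a b []. Qed.
Lemma ImD z w : Im (z + w) = Im z + Im w. Proof. by case: z w => a b []. Qed.
Lemma ReN z : Re (- z) = - Re z. Proof. by case: z. Qed.
Lemma ImN z : Im (- z) = - Im z. Proof. by case: z. Qed.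
Lemma ReB z w : Re (z - w) = Re z - Re w. Proof. by rewrite ReD ReN. Qed.
Lemma ImB z w : Im (z - w) = Im z - Im w. Proof. by rewrite ImD ImN. Qed.
Lemma ReM z w : Re (z * w) = Re z * Re w - Im z * Im w.
Proof. by case: z w => a b []. Qed.
Lemma ImM z w : Im (z * w) = Re z * Im w + Im z * Re w.
Proof. by case: z w => a b []. Qed.
Lemma Re0 : Re (0 : C) = 0. Proof. by []. Qed.
Lemma Im0 : Im (0 : C) = 0. Proof. by []. Qed.
Lemma Re1 : Re (1 : C) = 1. Proof. by []. Qed.
Lemma Im1 : Im (1 : C) = 0. Proof. by []. Qed.
Lemma Re_toC x : Re (toC x : C) = x. Proof. by []. Qed.
Lemma Im_toC x : Im (toC x : C) = 0. Proof. by []. Qed.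
Lemma ReV z : Re (z^-1) = Re z / (Re z ^+ 2 + Im z ^+ 2).
Proof. by case: z. Qed.
Lemma ImV z : Im (z^-1) = - (Im z / (Re z ^+ 2 + Im z ^+ 2)).
Proof. by case: z. Qed.

Definition complexE := (ReD, ImD, ReN, ImN, ReM, ImM, Re_toC, Im_toC,
  Re0, Im0, Re1, Im1).

Lemma toC_rmorph : GRing.monoid_morphism (@toC R) * additive (@toC R).
Proof.
by split; [split=> // x y|move=> x y]; apply: complexP; rewrite /= ?complexE /=; ring.
Qed.

Lemma toC_additive : additive (@toC R). Proof. by have [] := toC_rmorph. Qed.
Lemma toC_multiplicative : GRing.monoid_morphism (@toC R).
Proof. by have [] := toC_rmorph. Qed.
HB.instance Definition _ := GRing.isAdditive.Build R C (@toC R) toC_additive.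
HB.instance Definition _ := GRing.isMonoidMorphism.Build R C (@toC R) toC_multiplicative.

Lemma sum_complexE (I : Type) (r : seq I) (f : I -> C) :
  (Re (\sum_(i <- r) f i) = \sum_(i <- r) Re (f i)) *
  (Im (\sum_(i <- r) f i) = \sum_(i <- r) Im (f i)).
Proof.
by split; elim: r => [|i r IH]; rewrite ?big_nil// !big_cons complexE IH.
Qed.

Lemma normcE z : `|z| = toC (normc z). Proof. by case: z. Qed.

Lemma normcD z w : normc (z + w) <= normc z + normc w.
Proof.
have := ler_normD z w; rewrite !normcE -raddfD /=.
by rewrite lecE/= => /andP[].
Qed.

Lemma normc_ge0 z : 0 <= normc z. Proof. by case: z => a b; exact: sqrtr_ge0. Qed.
Lemma normcN z : normc (- z) = normc z.
Proof. by case: z => a b /=; rewrite !sqrrN. Qed.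
Lemma normcB z w : normc (z - w) = normc (w - z).
Proof. by rewrite -normcN opprB. Qed.
Lemma normc_eq0 z : (normc z == 0) = (z == 0).
Proof.
apply/eqP/eqP => [/Normc.eq0_normc//|->]; exact: Normc.normc0.
Qed.
Lemma normc_gt0 z : (0 < normc z) = (z != 0).
Proof. by rewrite lt_def normc_ge0 andbT normc_eq0. Qed.
Lemma sqr_normc z : normc z ^+ 2 = Re z ^+ 2 + Im z ^+ 2.
Proof. by case: z => a b /=; rewrite sqr_sqrtr// addr_ge0// sqr_ge0. Qed.
Lemma le_Re_normc z : `|Re z| <= normc z.
Proof.
case: z => a b /=; rewrite -sqrtr_sqr ler_sqrt ?lerDl ?sqr_ge0//.
by rewrite addr_ge0// sqr_ge0.
Qed.
Lemma le_Im_normc z : `|Im z| <= normc z.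
Proof.
case: z => a b /=; rewrite -sqrtr_sqr ler_sqrt ?lerDr ?sqr_ge0//.
by rewrite addr_ge0// sqr_ge0.
Qed.
Lemma normc_le_ReIm z : normc z <= `|Re z| + `|Im z|.
Proof.
rewrite -(@ler_pXn2r _ 2)// ?nnegrE ?normc_ge0 ?addr_ge0//.
rewrite sqr_normc sqrrD !real_normK ?num_real// lerD2r lerDl.
by rewrite mulrn_wge0// mulr_ge0.
Qed.
Lemma normc_toC x : normc (toC x : C) = `|x|.
Proof. by rewrite /= expr0n addr0 sqrtr_sqr. Qed.

(** Balls of [C] have radii in [C], but a positive element of [C] is real. Real radii let all
    estimates be made with [normc] in [R]. *)
Lemma nearC z (P : set C) :
  (\forall w \near z, P w) <->
  exists2 e : R, 0 < e & forall w, normc (w - z) < e -> P w.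
Proof.
split.
  move=> /nbhs_ballP[e /= e0 H].
  have ere : e = toC (Re e).
    by apply: complexP => //; move: e0; rewrite ltcE/= => /andP[/eqP ->].
  have e0' : 0 < Re e by move: e0; rewrite ltcE/= => /andP[].
  exists (Re e) => // w wz; apply: H => /=; rewrite /ball /= distrC normcE ere.
  by rewrite ltcE /= eqxx.
move=> [e e0 H]; apply/nbhs_ballP; exists (toC e) => /=.
  by rewrite ltcE/= eqxx.
move=> w; rewrite /ball/= distrC normcE ltcE /= => /andP[_ ?]; exact: H.
Qed.

Lemma cvgC_normc (T : Type) (F : set_system T) {FF : Filter F} (f : T -> C) (l : C) :
  (f x @[x --> F] --> l) <-> (normc (f x - l) @[x --> F] --> 0).
Proof.
split.
  move=> fl; apply/cvgr0Pnorm_lt => e e0.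
  have ln : \forall w \near l, normc (w - l) < e by apply/nearC; exists e.
  have : \forall x \near F, normc (f x - l) < e by exact: (fl _ ln).
  by apply: filterS => x /=; rewrite ger0_norm ?normc_ge0.
move=> /cvgr0Pnorm_lt fl A /nearC[e e0 H].
have := fl _ e0; apply: filterS => x; rewrite ger0_norm ?normc_ge0//.
exact: H.
Qed.

Lemma cvgC_Re (T : Type) (F : set_system T) {FF : Filter F} (f : T -> C) (l : C) :
  (f x @[x --> F] --> l) -> Re (f x) @[x --> F] --> Re l.
Proof.
move=> /cvgC_normc/cvgr0Pnorm_lt fl; apply/cvgrPdist_lt => e /fl.
apply: filterS => x; rewrite ger0_norm ?normc_ge0// distrC -ReB.
by apply: le_lt_trans; exact: le_Re_normc.
Qed.

Lemma cvgC_Im (T : Type) (F : set_system T) {FF : Filter F} (f : T -> C) (l : C) :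
  (f x @[x --> F] --> l) -> Im (f x) @[x --> F] --> Im l.
Proof.
move=> /cvgC_normc/cvgr0Pnorm_lt fl; apply/cvgrPdist_lt => e /fl.
apply: filterS => x; rewrite ger0_norm ?normc_ge0// distrC -ImB.
by apply: le_lt_trans; exact: le_Im_normc.
Qed.

Lemma cvgC_ReIm (T : Type) (F : set_system T) {FF : Filter F} (f : T -> C) (l : C) :
  Re (f x) @[x --> F] --> Re l -> Im (f x) @[x --> F] --> Im l ->
  (f x @[x --> F] --> l).
Proof.
move=> fr fi; apply/cvgC_normc/cvgr0Pnorm_le => e e0.
have e20 : 0 < e / 2 by rewrite divr_gt0.
move/cvgrPdist_le : fr => /(_ _ e20); move/cvgrPdist_le : fi => /(_ _ e20).
apply: filterS2 => x H1 H2; rewrite ger0_norm ?normc_ge0//.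
rewrite (le_trans (normc_le_ReIm _))// ReB ImB [leRHS](splitr e).
by rewrite lerD// distrC.
Qed.

Lemma cvgC_normcl (T : Type) (F : set_system T) {FF : Filter F} (f : T -> C) (l : C) :
  (f x @[x --> F] --> l) -> normc (f x) @[x --> F] --> normc l.
Proof.
move=> /cvgC_normc/cvgr0Pnorm_lt fl; apply/cvgrPdist_lt => e /fl.
apply: filterS => x; rewrite ger0_norm ?normc_ge0//; apply: le_lt_trans.
have H1 := normcD (f x - l) l; have H2 := normcD (l - f x) (f x).
rewrite normcB; rewrite !subrK in H1 H2; rewrite normcB in H1.
by rewrite ler_norml; lra.
Qed.

Lemma cvgC_unique (T : Type) (F : set_system T) {FF : ProperFilter F} (f : T -> C) (l l' : C) :
  f x @[x --> F] --> l -> f x @[x --> F] --> l' -> l = l'.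
Proof.
move=> fl fl'; apply: complexP.
  exact: (cvg_unique _ (cvgC_Re fl) (cvgC_Re fl')).
exact: (cvg_unique _ (cvgC_Im fl) (cvgC_Im fl')).
Qed.

Lemma cexpD z w : cexp (z + w) = cexp z * cexp w.
Proof.
by apply: complexP; rewrite /= !complexE expRD ?cosD ?sinD; ring.
Qed.

Lemma normc_cexp z : normc (cexp z) = expR (Re z).
Proof.
rewrite /= !exprMn -mulrDr cos2Dsin2 mulr1 sqrtr_sqr ger0_norm// expR_ge0.
Qed.

Lemma cexp_neq0 z : cexp z != 0.
Proof. by rewrite -normc_gt0 normc_cexp expR_gt0. Qed.

Lemma cexp0 : cexp (0 : C) = 1.
Proof. by apply: complexP; rewrite /= expR0 ?cos0 ?sin0 ?mulr1 ?mulr0. Qed.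

Lemma cexpMn z n : cexp (z * n%:R) = cexp z ^+ n.
Proof.
elim: n => [|n IH]; first by rewrite mulr0 cexp0.
by rewrite -natr1 mulrDr mulr1 cexpD IH exprSr.
Qed.

Lemma cexp_clog w : w != 0 -> cexp (clog w) = w.
Proof.
move=> w0; have nw : 0 < normc w by rewrite normc_gt0.
have H : -1 <= Re w / normc w <= 1.
  by rewrite -ler_norml normrM normfV (ger0_norm (ltW nw)) ler_pdivrMr// mul1r le_Re_normc.
have cosE : cos (carg w) = Re w / normc w.
  by rewrite /carg; case: ifP => _; rewrite ?cosN acosK.
have sinE : sin (carg w) = Im w / normc w.
  (* [acos] only produces nonnegative sines; the missing sign is the one that selects the branch of
     [carg]. *)
  have -> : Im w / normc w = (if 0 <= Im w then 1 else -1) * `|Im w / normc w|.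
    rewrite normrM normfV (ger0_norm (ltW nw)).
    case: lerP => wi; first by rewrite ger0_norm// mul1r.
    by rewrite ltr0_norm// mulN1r mulNr opprK.
  have -> : `|Im w / normc w| = Num.sqrt (1 - (Re w / normc w) ^+ 2).
    rewrite -sqrtr_sqr; congr Num.sqrt; rewrite !expr_div_n sqr_normc.
    field; rewrite -sqr_normc sqrf_eq0 gt_eqF//.
  by rewrite /carg; case: ifP => _; rewrite ?sinN sin_acos// ?mul1r ?mulN1r.
rewrite /clog /cexp /= cosE sinE lnK ?posrE//.
by apply: complexP => /=; field; rewrite gt_eqF.
Qed.

(** Near a positive real, [|carg w| = acos (Re w / normc w)] on both branches, so the argument tends
    to 0 as soon as this quotient tends to 1. *)
Lemma cvg_clog (T : Type) (F : set_system T) {FF : Filter F} (f : T -> C) x :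
  0 < x -> f t @[t --> F] --> (toC x : C) ->
  clog (f t) @[t --> F] --> (toC (ln x) : C).
Proof.
move=> x0 fx; have nx : normc (f t) @[t --> F] --> x.
  rewrite -[X in _ --> X](ger0_norm (ltW x0)) -normc_toC.
  exact: cvgC_normcl.
apply: cvgC_ReIm => /=.
  by apply: continuous_cvg nx; exact: continuous_ln.
have rx : Re (f t) / normc (f t) @[t --> F] --> (1 : R).
  rewrite -(divff (lt0r_neq0 x0)); apply: cvgM; first exact: cvgC_Re fx.
  by apply: cvgV => //; rewrite gt_eqF.
have nx0 : \forall t \near F, 0 < normc (f t) by exact: (cvgr_gt _ nx).
(* The truncation keeps [e'] inside [[0, pi]], where [cos] is strictly decreasing and comparisons of
   angles become comparisons of cosines. *)
apply/cvgr0Pnorm_lt => e e0; pose e' := Num.min e (pi / 2).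
have e'0 : 0 < e' by rewrite lt_min e0 divr_gt0// pi_gt0.
have e'pi : e' <= pi by rewrite ge_min; apply/orP; right; have := pi_ge0 R; lra.
have ce1 : cos e' < 1.
  by rewrite -cos0 ltr_cos// in_itv/= ?lexx ?pi_ge0// ltW// e'pi.
apply: filterS2 nx0 (cvgr_gt _ rx _ ce1) => t; set w := f t => nw H.
have Hw : -1 <= Re w / normc w <= 1.
  by rewrite -ler_norml normrM normfV (ger0_norm (ltW nw)) ler_pdivrMr// mul1r le_Re_normc.
have -> : `|carg w| = acos (Re w / normc w).
  by rewrite /carg; case: ifP => _; rewrite ?normrN ger0_norm// acos_ge0.
apply: (@lt_le_trans _ _ e'); last by rewrite ge_min lexx.
rewrite -ltr_cos ?acosK// in_itv/= ?acos_ge0 ?acos_lepi//.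
by rewrite (ltW e'0) e'pi.
Qed.

End complex_numbers.

(** * Bernstein polynomials as binomial means *)

Section bernstein.
Context {R : realType}.
Implicit Types (f g : nat -> R) (x : R).

(* The value at [x] is the mean of [f] under the binomial law of parameters [n], [x]. *)
Fixpoint bernstein (n : nat) f : {poly R} :=
  if n is m.+1 then (1 - 'X) * bernstein m f + 'X * bernstein m (f \o S)
  else (f 0)%:P.

Lemma bernsteinS n f x : (bernstein n.+1 f).[x] =
  (1 - x) * (bernstein n f).[x] + x * (bernstein n (f \o S)).[x].
Proof. by rewrite /= !hornerE. Qed.

Lemma le_bernstein n f g x : 0 <= x <= 1 ->
  (forall k, (k <= n)%N -> f k <= g k) -> (bernstein n f).[x] <= (bernstein n g).[x].
Proof.
move=> /andP[x0 x1]; elim: n f g => [|n IH] f g fg.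
  by rewrite /= !hornerC fg.
rewrite !bernsteinS lerD// ler_wpM2l ?subr_ge0// IH// => k kn; apply: fg => //.
exact: leqW.
Qed.

(** The shift [s] makes the induction work, since the recursion replaces [k] by [k + 1]. With
    [s = - (n * x)] the formula is the binomial variance. *)
Lemma bernstein_sqr n x (a b s : R) :
  (bernstein n (fun k => a + b * (k%:R + s) ^+ 2)).[x] =
  a + b * (n%:R * x * (1 - x) + (n%:R * x + s) ^+ 2).
Proof.
elim: n s => [|n IH] s; first by rewrite /= hornerC; ring.
have E : (fun k => a + b * (k%:R + s) ^+ 2) \o S =1
         (fun k => a + b * (k%:R + (1 + s)) ^+ 2).
  by move=> k /=; rewrite -natr1 addrA.
by rewrite bernsteinS (funext E) !IH -natr1; ring.
Qed.

End bernstein.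

(** * Weierstrass approximation on the unit segment *)

Section weierstrass.
Context {R : realType}.
Implicit Types (g : R -> R).

Lemma continuous01_bounded g : (forall x : R, 0 <= x <= 1 -> {for x, continuous g}) ->
  exists2 K : R, 0 <= K & forall x : R, 0 <= x <= 1 -> `|g x| <= K.
Proof.
move=> cg.
have := @segment_compact R 0 1.
(* Compactness in near-covering form: a bound valid near each point for all large [i] is valid on
   the whole segment for all large [i]. *)
move=> /compact_near_coveringP/(_ R (+oo : set_system R)
  (fun i x => `|g x| <= i) _).
have H (x : R) : `[0, 1]%classic x ->
    \forall x' \near x & i \near (+oo : set_system R), `|g x'| <= i.
  rewrite /= in_itv/= => /cg/cvgrPdist_lt/(_ _ ltr01) gx.
  near=> x' i; have : `|g x - g x'| < 1 by near: x'.
  have : `|g x| + 1 <= i by near: i; apply: nbhs_pinfty_ge; exact: num_real.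
  by move=> /= H1; have := ler_normB (g x) (g x - g x'); rewrite subKr; lra.
move=> /(_ H) H1.
near (pinfty_nbhs R) => K.
exists K; first by near: K; apply: nbhs_pinfty_ge; exact: num_real.
by move=> x x01; move: x x01; near: K; apply: filterS H1 => i + x x01; apply; rewrite /= in_itv.
Unshelve. all: by end_near. Qed.

(** Uniform continuity with a quadratic penalty instead of a distance threshold: in this form it can
    be averaged against the binomial law, whose second moment is explicit. *)
Lemma continuous01_modulus g : (forall x : R, 0 <= x <= 1 -> {for x, continuous g}) ->
  forall e : R, 0 < e -> exists2 L : R, 0 <= L & forall x y : R, 0 <= x <= 1 -> 0 <= y <= 1 ->
    `|g x - g y| <= e + L * (x - y) ^+ 2.
Proof.
move=> cg e e0; have [K K0 gK] := continuous01_bounded cg.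
have := @segment_compact R 0 1.
move=> /compact_near_coveringP/(_ R (+oo : set_system R)
  (fun L x => 0 <= x <= 1 -> forall y : R, 0 <= y <= 1 ->
    `|g x - g y| <= e + L * (x - y) ^+ 2) _).
have H (x : R) : `[0, 1]%classic x ->
    \forall x' \near x & L \near (+oo : set_system R), 0 <= x' <= 1 ->
     forall y : R, 0 <= y <= 1 -> `|g x' - g y| <= e + L * (x' - y) ^+ 2.
  have e20 : 0 < e / 2 by rewrite divr_gt0.
  rewrite /= in_itv/= => /cg/cvgrPdist_lt/(_ _ e20)/nbhs_ballP[d /= d0 gx].
  have d20 : 0 < d / 2 by rewrite divr_gt0.
  near=> x' L => x'01 y y01.
  have x'x : `|x - x'| < d / 2 by near: x'; apply/nbhs_ballP; exists (d / 2).
  (* If [y] is at distance at least [d] from [x], it is at least [d / 2] away from [x'], and the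
     penalty alone must then dominate the crude bound [2 * K]. *)
  have L0 : 2 * K / (d / 2) ^+ 2 <= L.
    by near: L; apply: nbhs_pinfty_ge; exact: num_real.
  have [yx|yx] := ltP `|x - y| d.
    have gxy := gx _ yx.
    have gxx : `|g x - g x'| < e / 2 by apply: gx; rewrite /ball/=; lra.
    have L0' : 0 <= L by apply: le_trans L0; rewrite !mulr_ge0// invr_ge0 exprn_ge0// ltW.
    have := mulr_ge0 L0' (sqr_ge0 (x' - y)).
    rewrite distrC in gxx; have := ler_distD (g x) (g x') (g y).
    by move: gxy; rewrite /=; lra.
  have dxy : d / 2 <= `|x' - y|.
    by have := ler_distD x' x y; lra.
  have : (d / 2) ^+ 2 <= (x' - y) ^+ 2.
    by rewrite -(real_normK (num_real (x' - y))) ler_pXn2r// ?nnegrE// ltW.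
  have d2 : 0 < (d / 2) ^+ 2 by rewrite exprn_gt0.
  move=> dd; rewrite ler_pdivrMr// in L0.
  have L0' : 0 <= L.
    by rewrite -(pmulr_lge0 _ d2); apply: le_trans L0; rewrite mulr_ge0.
  have := ler_wpM2l L0' dd.
  have := ler_normB (g x') (g y); have := gK _ x'01; have := gK _ y01; rewrite /=; lra.
move=> /(_ H) H1.
near (pinfty_nbhs R) => L.
exists L; first by near: L; apply: nbhs_pinfty_ge; exact: num_real.
move=> x y x01; move: x x01 y; near: L; apply: filterS H1 => i H1 x x01.
by apply: H1; rewrite /= ?in_itv.
Unshelve. all: by end_near. Qed.

(** Binomial means preserve order, so the envelopes [g x + (e / 2 + L (k / n - x)^2)] and
    [g x - (e / 2 + L (k / n - x)^2)] pass to the means; these deviate from [g x] by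
    [e / 2 + L x (1 - x) / n], hence the requirement [L / n <= e / 2]. *)
Lemma weierstrass01 g : (forall x : R, 0 <= x <= 1 -> {for x, continuous g}) ->
  forall e : R, 0 < e -> exists p : {poly R}, forall x : R, 0 <= x <= 1 -> `|g x - p.[x]| <= e.
Proof.
move=> cg e e0; have e20 : 0 < e / 2 by rewrite divr_gt0.
have [L L0 gL] := continuous01_modulus cg e20.
have [n n0 Ln] : exists2 n, (0 < n)%N & L / n%:R <= e / 2.
  exists (Num.truncn (L / (e / 2))).+1 => //.
  rewrite ler_pdivrMr ?ltr0n// -ler_pdivrMl// mulrC ltW//.
  by rewrite truncnS_gt.
have nR : (0 : R) < n%:R by rewrite ltr0n.
exists (bernstein n (fun k => g (k%:R / n%:R))) => x x01.
have kn k : (k <= n)%N -> 0 <= (k%:R / n%:R : R) <= 1.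
  by move=> kn; rewrite divr_ge0//= ler_pdivrMr// mul1r ler_nat.
have E c k : c * (k%:R / n%:R - x) ^+ 2 = c / n%:R ^+ 2 * (k%:R + - (n%:R * x)) ^+ 2.
  by field; rewrite gt_eqF.
have xx : x * (1 - x) <= 1 by case/andP: x01 => ? ?; nra.
have F c : c / n%:R ^+ 2 * (n%:R * x * (1 - x) + (n%:R * x + - (n%:R * x)) ^+ 2) =
   c / n%:R * (x * (1 - x)) by field; rewrite gt_eqF.
have Lx : L / n%:R * (x * (1 - x)) <= e / 2.
  by rewrite (le_trans _ Ln)// ler_piMr// divr_ge0// ltW.
have up : (bernstein n (fun k => g (k%:R / n%:R))).[x] <= g x + e.
  pose h k := (g x + e / 2) + L / n%:R ^+ 2 * (k%:R + - (n%:R * x)) ^+ 2.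
  apply: (@le_trans _ _ (bernstein n h).[x]).
    apply: le_bernstein => // k /kn k01; rewrite /h -E.
    by have := gL _ _ k01 x01; rewrite ler_norml; lra.
  by rewrite /h bernstein_sqr F; lra.
have lo : g x - e <= (bernstein n (fun k => g (k%:R / n%:R))).[x].
  pose h k := (g x - e / 2) + - L / n%:R ^+ 2 * (k%:R + - (n%:R * x)) ^+ 2.
  apply: (@le_trans _ _ (bernstein n h).[x]); last first.
    apply: le_bernstein => // k /kn k01; rewrite /h -E.
    by have := gL _ _ k01 x01; rewrite ler_norml; lra.
  by rewrite /h bernstein_sqr F; lra.
by rewrite ler_norml; lra.
Qed.

End weierstrass.

(** * Integration of bounded functions on the half-line *)

Section halfline_integral.
Context {R : realType}.
Local Notation halfline := (`[0 : R, +oo[%classic).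
Implicit Types (mu : {finite_measure set R -> \bar R}) (f g : R -> R).

Definition halfline_integral mu f : R := \int[mu]_(x in halfline) f x.

Definition halfline_mass mu : R := fine (mu halfline).

(** Both conditions concern the half-line only, because the kernel [1 / (s + x)] has a pole at
    [- s]. *)
Definition bounded_measurable f :=
  measurable_fun halfline f /\ exists K : R, forall x : R, 0 <= x -> `|f x| <= K.

Lemma halfline_mass_ge0 mu : 0 <= halfline_mass mu.
Proof. by rewrite fine_ge0. Qed.

Lemma halfline_integrable mu f : bounded_measurable f ->
  mu.-integrable halfline (EFin \o f).
Proof.
move=> [mf [K fK]]; apply: measurable_bounded_integrable => //.
  by rewrite ltey_eq fin_num_measure.
exists K; split; first exact: num_real.
by move=> M KM x /=; rewrite in_itv/= andbT => /fK /le_trans; apply; exact: ltW.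
Qed.

Lemma continuous_halfline_measurable f :
  (forall x : R, 0 <= x -> {for x, continuous f}) -> measurable_fun halfline f.
Proof.
move=> cf; apply: subspace_continuous_measurable_fun => //.
by apply: continuous_in_subspaceT => x /set_mem /=; rewrite in_itv/= andbT => /cf.
Qed.

Lemma bounded_measurable_lin f g a b : bounded_measurable f -> bounded_measurable g ->
  bounded_measurable (fun x => a * f x + b * g x).
Proof.
move=> [mf [K fK]] [mg [L gL]]; split.
  by apply: measurable_funD; apply: measurable_funM => //; exact: measurable_cst.
exists (`|a| * K + `|b| * L) => x x0; apply: le_trans (ler_normD _ _) _.
by rewrite !normrM lerD// ler_wpM2l// ?fK ?gL.
Qed.

Lemma halfline_integral_lin mu f g a b : bounded_measurable f -> bounded_measurable g ->
  halfline_integral mu (fun x => a * f x + b * g x) =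
  a * halfline_integral mu f + b * halfline_integral mu g.
Proof.
move=> bf bg; rewrite /halfline_integral RintegralD//; last 2 first.
- apply: halfline_integrable; have := bounded_measurable_lin a 0 bf bf.
  by congr bounded_measurable; apply/funext => x; rewrite mul0r addr0.
- apply: halfline_integrable; have := bounded_measurable_lin b 0 bg bg.
  by congr bounded_measurable; apply/funext => x; rewrite mul0r addr0.
by rewrite !RintegralZl//; exact: halfline_integrable.
Qed.

Lemma eq_halfline_integral mu f g : (forall x : R, 0 <= x -> f x = g x) ->
  halfline_integral mu f = halfline_integral mu g.
Proof.
move=> fg; apply: eq_Rintegral => x /set_mem/=.
by rewrite in_itv/= andbT => /fg.
Qed.

Lemma bounded_measurable_cst a : bounded_measurable (fun=> a).
Proof. by split; [exact: measurable_cst|exists `|a|]. Qed.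

Lemma halfline_integral_dist mu f g e : bounded_measurable f -> bounded_measurable g ->
  (forall x : R, 0 <= x -> `|f x - g x| <= e) ->
  `|halfline_integral mu f - halfline_integral mu g| <= e * halfline_mass mu.
Proof.
move=> bf bg fg.
have := halfline_integral_lin mu 1 (-1) bf bg.
rewrite mul1r mulN1r => <-.
have bfg := bounded_measurable_lin 1 (-1) bf bg.
apply: le_trans (le_normr_Rintegral _ _) _ => //; first exact: halfline_integrable.
rewrite /halfline_mass -Rintegral_cst//; apply: le_Rintegral => //.
- apply: (@integrable_abse _ _ _ mu halfline (EFin \o _)).
  exact: halfline_integrable bfg.
- exact: halfline_integrable (bounded_measurable_cst e).
- by move=> x /=; rewrite in_itv/= andbT => /fg; rewrite mul1r mulN1r.
Qed.

End halfline_integral.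

(** * From convergence on kernels to convergence on functions vanishing at infinity *)

Section convergence_of_integrals.
Context {R : realType}.
Variables (nu : nat -> {finite_measure set R -> \bar R}).
Variable (Z : {finite_measure set R -> \bar R}).
Variable (M : R).
Hypothesis nuM : forall n, halfline_mass (nu n) <= M.
Hypothesis ZM : halfline_mass Z <= M.
Implicit Types (f g : R -> R).

Definition integral_cvg f := bounded_measurable f /\
  halfline_integral (nu n) f @[n --> \oo] --> halfline_integral Z f.

Lemma integral_cvg_lin f g a b : integral_cvg f -> integral_cvg g ->
  integral_cvg (fun x => a * f x + b * g x).
Proof.
move=> [bf cf] [bg cg]; split; first exact: bounded_measurable_lin.
rewrite halfline_integral_lin//.
under eq_fun do rewrite halfline_integral_lin//.
by apply: cvgD; apply: cvgM => //; exact: cvg_cst.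
Qed.

Lemma integral_cvgZ f a : integral_cvg f -> integral_cvg (fun x => a * f x).
Proof.
move=> cf; have := integral_cvg_lin a 0 cf cf.
by congr integral_cvg; apply/funext => x; rewrite mul0r addr0.
Qed.

(** The common mass bound [M] makes a uniform error on the integrand cost the same under all the
    measures, so the approximation can be chosen before [n]. *)
Lemma integral_cvg_unif f : bounded_measurable f ->
  (forall e : R, 0 < e -> exists2 g, integral_cvg g &
    forall x : R, 0 <= x -> `|f x - g x| <= e) -> integral_cvg f.
Proof.
move=> bf H; split=> //; apply/cvgrPdist_le => e e0.
have M0 : 0 <= M by apply: le_trans ZM; exact: halfline_mass_ge0.
(* One third for each replacement of [f] by [g] and one for the convergence on [g]; [M + 1] avoids a
   division by 0 when [M = 0]. *)
have M10 : 0 < 3 * (M + 1) by rewrite mulr_gt0// ltr_wpDl.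
have d0 : 0 < e / (3 * (M + 1)) by rewrite divr_gt0.
have [g [bg cg] fg] := H _ d0.
have e3 : 0 < e / 3 by rewrite divr_gt0.
have eM m : m <= M -> e / (3 * (M + 1)) * m <= e / 3.
  move=> mM; apply: (@le_trans _ _ (e / (3 * (M + 1)) * (M + 1))).
    by rewrite ler_wpM2l// ?ltW//; lra.
  by rewrite le_eqVlt; apply/orP; left; apply/eqP; field; lra.
move/cvgrPdist_le: cg => /(_ _ e3); apply: filterS => n.
have := le_trans (halfline_integral_dist Z bf bg fg) (eM _ ZM).
have := le_trans (halfline_integral_dist (nu n) bf bg fg) (eM _ (nuM n)).
by rewrite !ler_norml; lra.
Qed.

Lemma bounded_measurable_kernel m (s : R) : 0 < s ->
  bounded_measurable (fun x => (s + x)^-1 ^+ m).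
Proof.
move=> s0; split.
  apply: continuous_halfline_measurable => x x0.
  apply: (@continuous_comp _ _ _ (fun x : R => (s + x)^-1) (fun y => y ^+ m)).
    apply: cvgV; first by rewrite gt_eqF// ltr_pwDl.
    by apply: cvgD; [exact: cvg_cst|exact: cvg_id].
  exact: exprn_continuous.
exists (s^-1 ^+ m) => x x0; have sx : 0 < s + x by rewrite ltr_pwDl.
rewrite ger0_norm ?exprn_ge0 ?invr_ge0 ?(ltW sx)//.
by apply: lerXn2r; rewrite ?nnegrE ?invr_ge0 ?(ltW s0) ?(ltW sx)// lef_pV2 ?posrE// lerDl.
Qed.

(** The model is [y = 1 / (s + x)], [y' = 1 / (s + h + x)], where differentiating a power in [s]
    raises the exponent. The geometric sum [t] lies between [(m + 1) y'^m] and [(m + 1) y^m], which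
    encloses the quotient between [y y'^(m+1)] and [y^(m+2)]. *)
Lemma diff_quotient_pow m (y y' h : R) : 0 < h -> 0 <= y' -> y' <= y -> y - y' = h * y * y' ->
  `|y ^+ m.+2 - (y ^+ m.+1 - y' ^+ m.+1) / (h * m.+1%:R)| <= h * m.+1%:R * y ^+ m.+3.
Proof.
move=> h0 y'0 y'y yy.
have y0 : 0 <= y by exact: le_trans y'y.
have m0 : 0 < m.+1%:R :> R by rewrite ltr0n.
pose t := \sum_(i < m.+1) y ^+ (m - i) * y' ^+ i.
have tE : (y ^+ m.+1 - y' ^+ m.+1) / (h * m.+1%:R) = y * y' * t / m.+1%:R.
  by rewrite subrXX yy -/t; field; rewrite !gt_eqF.
have le_t : t <= m.+1%:R * y ^+ m.
  rewrite mulr_natl -[leRHS]mulr_natl -[in leRHS](card_ord m.+1) -sum1_card natr_sum mulr_suml.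
  apply: ler_sum => i _; rewrite mul1r -[in leRHS](@subnK i m) -1?ltnS// exprD.
  by rewrite ler_wpM2l ?exprn_ge0// lerXn2r ?nnegrE.
have ge_t : m.+1%:R * y' ^+ m <= t.
  rewrite -[in leLHS](card_ord m.+1) -sum1_card natr_sum mulr_suml.
  apply: ler_sum => i _; rewrite mul1r -[in leLHS](@subnK i m) -1?ltnS// exprD.
  by rewrite ler_wpM2r ?exprn_ge0// lerXn2r ?nnegrE.
rewrite tE.
have q_le : y * y' * t / m.+1%:R <= y ^+ m.+2.
  rewrite ler_pdivrMr//; apply: (@le_trans _ _ (y * y * (m.+1%:R * y ^+ m))).
    by rewrite ler_pM// ?mulr_ge0 ?sumr_ge0// ?ler_wpM2l// => i _; rewrite mulr_ge0 ?exprn_ge0.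
  by rewrite !exprS le_eqVlt; apply/orP; left; apply/eqP; ring.
have q_ge : y * y' ^+ m.+1 <= y * y' * t / m.+1%:R.
  rewrite ler_pdivlMr// exprS -!mulrA ler_wpM2l// ler_wpM2l//.
  by rewrite mulrC.
have yB : y ^+ m.+1 - y' ^+ m.+1 <= h * m.+1%:R * y ^+ m.+2.
  rewrite subrXX -/t yy; apply: (@le_trans _ _ (h * y * y * (m.+1%:R * y ^+ m))).
    rewrite ler_pM// ?mulr_ge0 ?(ltW h0) ?sumr_ge0//.
      by move=> i _; rewrite mulr_ge0 ?exprn_ge0.
    by rewrite ler_wpM2l// mulr_ge0// ltW.
  by rewrite !exprS le_eqVlt; apply/orP; left; apply/eqP; ring.
have := ler_wpM2l y0 yB; rewrite ger0_norm ?subr_ge0//.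
have -> : y * (h * m.+1%:R * y ^+ m.+2) = h * m.+1%:R * y ^+ m.+3 by rewrite !exprS; ring.
by move=> H; apply: le_trans H; rewrite mulrBr -exprS lerB.
Qed.

Variables (a b : R).
Hypothesis a0 : 0 < a.
Hypothesis kernel_cvg : forall s : R, a < s -> s < b -> integral_cvg (fun x => (s + x)^-1).

Lemma kernel_pow_cvg m (s : R) : a < s -> s < b -> integral_cvg (fun x => (s + x)^-1 ^+ m.+1).
Proof.
elim: m s => [|m IH] s sa sb; first by have := kernel_cvg sa sb.
have s0 : 0 < s := lt_trans a0 sa.
apply: integral_cvg_unif; first exact: bounded_measurable_kernel.
move=> e e0.
(* Since [1 / (s + x) <= 1 / s] on the half-line, [h * c] bounds the error of the difference
   quotient uniformly in [x]; the other constraint on [h] keeps [s + h] below [b]. *)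
pose c := m.+1%:R * s^-1 ^+ m.+3.
have c0 : 0 < c by rewrite mulr_gt0// exprn_gt0// invr_gt0.
pose h := Num.min ((b - s) / 2) (e / c).
have h0 : 0 < h by rewrite lt_min !divr_gt0// subr_gt0.
have hb : s + h < b.
  have : h <= (b - s) / 2 by rewrite ge_min lexx.
  lra.
have hc : h * c <= e by rewrite -ler_pdivlMr// ge_min lexx orbT.
pose q := (h * m.+1%:R)^-1.
exists (fun x => q * (s + x)^-1 ^+ m.+1 + (- q) * (s + h + x)^-1 ^+ m.+1).
  by apply: integral_cvg_lin; apply: IH => //; rewrite (lt_trans sa)// ltrDl.
move=> x x0; rewrite mulNr -mulrBr mulrC.
have sx : 0 < s + x by rewrite ltr_pwDl.
have shx : 0 < s + h + x by lra.
apply: le_trans (diff_quotient_pow _ h0 _ _ _) _.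
- by rewrite invr_ge0 ltW.
- by rewrite lef_pV2 ?posrE//; lra.
- by field; rewrite !gt_eqF.
apply: le_trans hc; rewrite -mulrA ler_wpM2l ?(ltW h0)//.
rewrite ler_wpM2l//; apply: lerXn2r; rewrite ?nnegrE ?invr_ge0 ?(ltW s0) ?(ltW sx)//.
by rewrite lef_pV2 ?posrE// lerDl.
Qed.

Lemma kernel_poly_cvg (p : {poly R}) (s : R) : a < s -> s < b ->
  integral_cvg (fun x => p.[s / (s + x)] * (s / (s + x))).
Proof.
move=> sa sb.
have E n (c : nat -> R) :
    integral_cvg (fun x => \sum_(i < n) c i * (s + x)^-1 ^+ i.+1).
  elim: n => [|n IH].
    have := integral_cvgZ 0 (kernel_cvg sa sb).
    by congr integral_cvg; apply/funext => x; rewrite big_ord0 mul0r.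
  have := integral_cvg_lin 1 (c n) IH (kernel_pow_cvg n sa sb).
  by congr integral_cvg; apply/funext => x; rewrite big_ord_recr/= mul1r.
have := E (size p) (fun i => p`_i * s ^+ i.+1); congr integral_cvg.
apply/funext => x; rewrite horner_coef mulr_suml; apply: eq_bigr => i _.
by rewrite -[LHS]mulrA -exprMn -[RHS]mulrA -exprSr.
Qed.

(* The substitution [y = s / (s + x)] maps the half-line into ]0, 1], where
   polynomials without constant term approximate [y * g y] uniformly. *)
Lemma continuous_kernel_cvg g f (s : R) : a < s -> s < b -> bounded_measurable f ->
  (forall y : R, 0 <= y <= 1 -> {for y, continuous g}) ->
  (forall x : R, 0 <= x -> f x = g (s / (s + x)) * (s / (s + x))) ->
  integral_cvg f.
Proof.
move=> sa sb bf cg fE; apply: integral_cvg_unif => // e e0.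
have s0 : 0 < s := lt_trans a0 sa.
have [p gp] := weierstrass01 cg e0.
exists (fun x => p.[s / (s + x)] * (s / (s + x))); first exact: kernel_poly_cvg.
move=> x x0; rewrite fE// -mulrBl normrM.
have y0 : 0 <= s / (s + x) by rewrite divr_ge0 ?ltW// ltr_pwDl.
have y1 : s / (s + x) <= 1 by rewrite ler_pdivrMr ?mul1r ?lerDl// ltr_pwDl.
rewrite (ger0_norm y0) (le_trans _ (gp (s / (s + x)) _))//; last by rewrite y0.
by rewrite ler_piMr.
Qed.

End convergence_of_integrals.

(** * Limits of bounded sequences along an ultrafilter *)

Section ultrafilter_limit.
Context {R : realType}.

Lemma cvg_sum_ord (T : Type) (F : set_system T) {FF : Filter F} n
    (f : nat -> T -> R) (l : nat -> R) :
  (forall i, f i x @[x --> F] --> l i) ->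
  \sum_(i < n) f i x @[x --> F] --> \sum_(i < n) l i.
Proof.
move=> fl; elim: n => [|n IH].
  rewrite big_ord0; under eq_fun do rewrite big_ord0; exact: cvg_cst.
rewrite big_ord_recr/=; under eq_fun do rewrite big_ord_recr/=.
exact: cvgD.
Qed.

Lemma ultra_fmap (T S : Type) (f : T -> S) (U : set_system T) :
  UltraFilter U -> UltraFilter (f @ U).
Proof.
move=> UU; split; first exact: fmap_proper_filter.
move=> G PG UG; apply/seteqP; split => // A GA.
have [//|UC] := in_ultra_setVsetC (f @^-1` A) UU.
have /filter_ex[x [Ax nAx]] : G (A `&` ~` A) by apply: filterI => //; exact: UG.
by case: nAx.
Qed.

Lemma ultra_cvg_segment (U : set_system nat) (f : nat -> R) (a b : R) :
  UltraFilter U -> (forall n, a <= f n <= b) ->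
  exists2 l : R, a <= l <= b & f n @[n --> U] --> l.
Proof.
move=> UU fab; have := @segment_compact R a b.
rewrite compact_ultra => /(_ _ (ultra_fmap f UU)) [].
  by apply: (@filterE _ U) => n; rewrite /= in_itv/= fab.
by move=> l [/=]; rewrite in_itv/= => lab fl; exists l.
Qed.

End ultrafilter_limit.

(** * Uniform approximation of the kernel by step functions *)

Section step_approximation.
Context {R : realType}.
Variable (s : R) (N : nat).
Hypotheses (s0 : 0 < s) (N0 : (0 < N)%N).
Local Notation halfline := (`[0 : R, +oo[%classic).

(* [x <= step_point i] iff [(i + 1) / (N * s) <= 1 / (s + x)]. *)
Definition step_point (i : nat) : R := s * (N%:R / i.+1%:R) - s.

Let NR : 0 < N%:R :> R. Proof. by rewrite ltr0n. Qed.
Let iR i : 0 < i.+1%:R :> R. Proof. by rewrite ltr0n. Qed.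

Lemma step_point_ge0 i : (i < N)%N -> 0 <= step_point i.
Proof.
move=> iN; rewrite /step_point subr_ge0 -[leLHS]mulr1 ler_wpM2l ?(ltW s0)//.
by rewrite ler_pdivlMr// mul1r ler_nat.
Qed.

Lemma step_point_decr i : step_point i.+1 < step_point i.
Proof.
by rewrite /step_point ltrD2r !ltr_pM2l// ltf_pV2 ?posrE// ltr_nat.
Qed.

(** The sum counts the positive integers up to [v], so it is the integer part of [v]. *)
Lemma sum_floor n (v : R) : 0 <= v -> v <= n%:R ->
  v - 1 <= \sum_(i < n) ((i.+1%:R <= v)%R : nat)%:R <= v.
Proof.
elim: n => [|n IH] v0 vn; first by rewrite big_ord0; lra.
rewrite big_ord_recr/=; have [vn'|vn'] := leP v n%:R.
  have -> : (n.+1%:R <= v) = false by apply/negbTE; rewrite -ltNge -natr1; lra.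
  by rewrite addr0 IH.
rewrite (eq_bigr (fun=> 1)) => [|i _].
  rewrite sumr_const card_ord; rewrite -natr1 in vn *.
  by case: (leP (n%:R + 1) v) => ?; rewrite ?mulr1n ?addr0; apply/andP; split; lra.
suff -> : i.+1%:R <= v by [].
by rewrite (le_trans _ (ltW vn'))// ler_nat.
Qed.

(** For [x >= 0] this is [floor (N s / (s + x)) / (N s)]. Slicing along the values of the kernel,
    not along the axis, gives a uniform error on an unbounded domain with finitely many steps. *)
Definition kernel_step (x : R) : R :=
  \sum_(i < N) (N%:R * s)^-1 * \1_(`[0, step_point i]%classic) x.

Lemma kernel_step_dist (x : R) : 0 <= x ->
  `|(s + x)^-1 - kernel_step x| <= (N%:R * s)^-1.
Proof.
move=> x0; have sx : 0 < s + x by rewrite ltr_pwDl.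
have Ns : 0 < N%:R * s by rewrite mulr_gt0.
pose v := N%:R * s / (s + x).
have v0 : 0 <= v by rewrite divr_ge0 ?ltW.
have vN : v <= N%:R by rewrite ler_pdivrMr// ler_wpM2l ?(ltW NR)// lerDl.
have stepE : kernel_step x = (N%:R * s)^-1 * \sum_(i < N) ((i.+1%:R <= v)%R : nat)%:R.
  rewrite mulr_sumr; apply: eq_bigr => i _; congr (_ * _).
  rewrite indicE mem_setE in_itv/= x0 /= /v /step_point lerBrDr ler_pdivlMr//.
  by rewrite [x + s]addrC mulrA ler_pdivlMr// [s * _]mulrC [(s + x) * _]mulrC.
have -> : (s + x)^-1 = (N%:R * s)^-1 * v.
  by rewrite /v; field; rewrite !gt_eqF.
rewrite stepE -mulrBr normrM ger0_norm ?invr_ge0 ?(ltW Ns)// ler_piMr ?invr_ge0 ?(ltW Ns)//.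
by have := sum_floor v0 vN; rewrite ler_norml; lra.
Qed.

Lemma bounded_measurable_step (n : nat) (c : R) (y : nat -> R) :
  bounded_measurable (fun x => \sum_(i < n) c * \1_(`[0, y i]%classic) x).
Proof.
elim: n => [|n IH].
  have := @bounded_measurable_cst R 0; congr bounded_measurable.
  by apply/funext => x; rewrite big_ord0.
have b1 : bounded_measurable (\1_(`[0, y n]%classic) : R -> R).
  split; first exact: measurable_indic.
  by exists 1 => x _; rewrite indicE ger0_norm// lern1 leq_b1.
have := bounded_measurable_lin 1 c IH b1; congr bounded_measurable.
by apply/funext => x; rewrite big_ord_recr/= mul1r.
Qed.

Lemma halfline_integral_step (mu : {finite_measure set R -> \bar R}) (n : nat)
    (c : R) (y : nat -> R) :
  halfline_integral mu (fun x => \sum_(i < n) c * \1_(`[0, y i]%classic) x) =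
  c * \sum_(i < n) fine (mu `[0, y i]%classic).
Proof.
elim: n => [|n IH].
  rewrite big_ord0 mulr0 -[RHS](mul0r (halfline_mass mu)) /halfline_mass.
  rewrite -Rintegral_cst//; apply: eq_halfline_integral => x _.
  by rewrite big_ord0.
have b1 : bounded_measurable (\1_(`[0, y n]%classic) : R -> R).
  split; first exact: measurable_indic.
  by exists 1 => x _; rewrite indicE ger0_norm// lern1 leq_b1.
have := halfline_integral_lin mu 1 c (bounded_measurable_step n c y) b1.
rewrite IH mul1r => H; rewrite big_ord_recr/= mulrDr.
have -> : fine (mu `[0, y n]%classic) = halfline_integral mu \1_(`[0, y n]%classic).
  rewrite /halfline_integral /Rintegral integral_indic//; congr (fine (mu _)).
  rewrite setIidl// => x /=; rewrite !in_itv/= => /andP[->]//.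
rewrite -H; apply: eq_halfline_integral => x _.
by rewrite big_ord_recr/= mul1r.
Qed.

Lemma halfline_integral_kernel_step (mu : {finite_measure set R -> \bar R}) :
  `|halfline_integral mu (fun x => (s + x)^-1) -
    (N%:R * s)^-1 * \sum_(i < N) fine (mu `[0, step_point i]%classic)|
  <= (N%:R * s)^-1 * halfline_mass mu.
Proof.
rewrite -halfline_integral_step; apply: halfline_integral_dist.
- by have := bounded_measurable_kernel 1 s0.
- exact: bounded_measurable_step.
- exact: kernel_step_dist.
Qed.

End step_approximation.

(** * Extraction of a limit measure from distribution functions *)

Section helly.
Context {R : realType}.
Local Notation halfline := (`[0 : R, +oo[%classic).

(* [lebesgue_stieltjes_measure] lives on a copy of [R] with another display. *)
Lemma lebesgue_stieltjes_real (F : cumulative R R) :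
  exists mu : {measure set R -> \bar R},
    forall a b, a <= b -> mu `]a, b]%classic = (F b - F a)%:E.
Proof.
pose ls := lebesgue_stieltjes_measure F : set R -> \bar R.
pose ls_mix := isMeasure.Build _ R R ls (measure0 (lebesgue_stieltjes_measure F))
  (measure_ge0 (lebesgue_stieltjes_measure F))
  (@measure_semi_sigma_additive _ _ _ (lebesgue_stieltjes_measure F)).
pose lsm : {measure set R -> \bar R} := HB.pack ls ls_mix.
exists lsm => a b ab; rewrite [LHS]/(lebesgue_stieltjes_measure F `]a, b]%classic).
rewrite /lebesgue_stieltjes_measure /measure_extension/=.
by rewrite measurable_mu_extE/= ?wlength_itv_bnd//; exact: is_ocitv.
Qed.

(* A pointwise limit [L] of distribution functions need not be right-continuous,
   hence the passage to [F x = inf_(q > x) L q] in the proof. *)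
Lemma measure_of_limit_cdf (L : R -> R) (M : R) :
  {homo L : x y / x <= y} -> (forall x, 0 <= L x <= M) -> (forall x, x < 0 -> L x = 0) ->
  exists Z : {finite_measure set R -> \bar R},
    [/\ supported_on_nonneg Z, halfline_mass Z <= M,
        (forall x, 0 <= x -> L x <= fine (Z `[0, x]%classic)) &
        (forall x y, 0 <= x -> x < y -> fine (Z `[0, x]%classic) <= L y)].
Proof.
move=> ndL L0M Lneg.
pose A x := [set L q | q in `]x, +oo[%classic].
pose F x := inf (A x).
have hlbA x : has_lbound (A x) by exists 0 => _ [q _ <-]; case/andP: (L0M q).
have hiA x : has_inf (A x).
  by split=> //; exists (L (x + 1)), (x + 1) => //=; rewrite in_itv/= andbT ltrDl.
have FleL x q : x < q -> F x <= L q.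
  by move=> xq; apply: ge_inf => //; exists q => //=; rewrite in_itv/= andbT.
have LleF x : L x <= F x.
  apply: lb_le_inf; first by case: (hiA x).
  by move=> _ [q /= + <-]; rewrite in_itv/= andbT => /ltW/ndL.
have F0 x : 0 <= F x by apply: le_trans (LleF x); case/andP: (L0M x).
have FM x : F x <= M.
  by apply: (le_trans (FleL x (x + 1) _)); [rewrite ltrDl|case/andP: (L0M (x + 1))].
have Fneg x : x < 0 -> F x = 0.
  move=> x0; apply/eqP; rewrite eq_le F0 andbT.
  have x20 : x < x / 2 by lra.
  by apply: le_trans (FleL _ _ x20) _; rewrite Lneg//; lra.
have ndF : nondecreasing F.
  move=> x y; rewrite le_eqVlt => /predU1P[->//|xy].
  by apply: le_trans (FleL _ _ xy) (LleF y).
have rcF : forall x, F @ at_right x --> F x.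
  move=> x; apply/cvgrPdist_lt => e e0.
  have [_ [q /= + <-] Lq] := inf_adherent e0 (hiA x).
  rewrite in_itv/= andbT => xq.
  near=> y; have xy : x < y by near: y; exact: nbhs_right_gt.
  have yq : y < q by near: y; exact: nbhs_right_lt.
  have := FleL _ _ yq; have := ndF _ _ (ltW xy); rewrite -/(F x) in Lq.
  by rewrite ltr_norml; lra.
pose mixF := isCumulative.Build R _ R F ndF rcF.
pose Fc : cumulative R R := HB.pack F mixF.
have [mu muFc] := lebesgue_stieltjes_real Fc.
have muE (a b : R) : a <= b -> mu `]a, b]%classic = (F b - F a)%:E by exact: muFc.
(* [F] may jump at 0, so the open interval is exhausted by half-open ones ending before 0, where [F]
   is still 0. This gives the possible atom at 0 to [[0, x]]. *)
have mu_neg : mu `]-1, 0[%classic = 0%E.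
  apply/negligibleP => //.
  have -> : `]-1, 0[%classic = \bigcup_k `](-1 : R), - k.+1%:R^-1]%classic.
    apply/seteqP; split=> x /=; rewrite in_itv/=.
      move=> /andP[x1 x0]; exists (Num.truncn (- x)^-1) => //=.
      rewrite in_itv/= x1 lerNr -[leRHS]invrK lef_pV2 ?posrE ?invr_gt0 ?oppr_gt0//.
      by rewrite ltW// truncnS_gt.
    move=> [k _ /=]; rewrite in_itv/= => /andP[-> /le_lt_trans]; apply.
    by rewrite oppr_lt0 invr_gt0.
  apply: negligible_bigcup => k; apply/negligibleP => //.
  have [k1|k1] := leP (-1) (- k.+1%:R^-1 : R); last first.
    by rewrite set_itv_ge ?measure0// bnd_simp -leNgt ltW.
  by apply: etrans (muE _ _ k1) _; rewrite !Fneg ?subrr// oppr_lt0 ?invr_gt0.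
have mu0 x : 0 <= x -> mu `[0, x]%classic = (F x)%:E.
  move=> x0; have := muE (-1) x; rewrite (Fneg (-1)) ?subr0 ?oppr_lt0// => <-; last lra.
  have -> : `]-1, x]%classic = `]-1, 0[%classic `|` `[0 : R, x]%classic.
    apply/seteqP; split=> y /=; rewrite !in_itv/=.
      by move=> /andP[-> ->]; case: (ltP y 0) => y0; [left|right].
    by move=> [/andP[-> y0]|/andP[y0 ->]]; rewrite ?andbT ?andTb; lra.
  rewrite measureU//; first by rewrite [X in (X + _)%E]mu_neg add0e.
  apply/seteqP; split=> y //=; rewrite !in_itv/= => -[/andP[_ y0] /andP[y1 _]].
  by move: y0; rewrite ltNge y1.
have mu_half : (mu halfline <= M%:E)%E.
  pose I n : set R := `[0, n%:R]%classic.
  have UI : halfline = \bigcup_n I n.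
    apply/seteqP; split=> y /=; rewrite ?in_itv/= ?andbT.
      by move=> y0; exists (Num.truncn y).+1 => //=; rewrite /I/= in_itv/= y0 ltW// truncnS_gt.
    by move=> [n _]; rewrite /I/= in_itv/= => /andP[].
  have : (mu \o I) n @[n --> \oo] --> mu (\bigcup_n I n).
    apply: nondecreasing_cvg_mu; rewrite /I//; first exact: bigcup_measurable.
    by move=> m n mn; apply/subsetPset/subset_itv; rewrite leBSide/= ?ler_nat.
  rewrite -UI => H; rewrite -(cvg_lim _ H)//; apply: lime_le.
    by apply/cvg_ex; exists (mu halfline).
  by apply: nearW => n; rewrite /= /I mu0// lee_fin.
have mu_fin : (mu halfline < +oo)%E by apply: le_lt_trans mu_half _; rewrite ltry.
have mh : measurable halfline by [].
(* [mu] lives on the whole line; its restriction to the half-line is finite by [mu_half] and has the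
   required support by construction. *)
exists (mfrestr mh mu_fin).
have ZE x : 0 <= x -> fine (mfrestr mh mu_fin `[0, x]%classic) = F x.
  move=> x0; rewrite /mfrestr /mrestr setIidl ?mu0// => y /=.
  by rewrite !in_itv/= => /andP[->].
split.
- rewrite /supported_on_nonneg /= /mfrestr /mrestr.
  have -> : `]-oo, 0[%classic `&` halfline = set0; last exact: measure0.
  by apply/seteqP; split=> y //= []; rewrite !in_itv/= andbT leNgt => ->.
- have -> : halfline_mass (mfrestr mh mu_fin) = fine (mu halfline).
    by rewrite /halfline_mass /= /mfrestr /mrestr setIid.
  by rewrite -lee_fin fineK// ge0_fin_numE.
- by move=> x x0; rewrite ZE.
- by move=> x y x0 xy; rewrite ZE// FleL.
Unshelve. all: by end_near. Qed.

(** At a jump the ultrafilter limit [L'] and the distribution function of [Z] may differ. The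
    inequalities [L' x <= Z [0, x] <= L' y] for [x < y] suffice, because the differences telescope
    along the decreasing step points. *)
Lemma helly_kernel (nu : nat -> {finite_measure set R -> \bar R}) (M : R) :
  (forall n, halfline_mass (nu n) <= M) ->
  exists (Z : {finite_measure set R -> \bar R}) (U : set_system nat),
    [/\ ProperFilter U, \oo `<=` U, supported_on_nonneg Z, halfline_mass Z <= M &
    forall s : R, 0 < s ->
      halfline_integral (nu n) (fun x => (s + x)^-1) @[n --> U] -->
      halfline_integral Z (fun x => (s + x)^-1)].
Proof.
move=> nuM; have [U [UU ooU]] := ultraFilterLemma eventually_filter.
pose Phi n (x : R) := fine (nu n `[0, x]%classic).
have Phi01 n x : 0 <= Phi n x <= M.
  rewrite fine_ge0//= (le_trans _ (nuM n))// fine_le ?fin_num_measure//.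
  by rewrite le_measure ?inE//; apply: subset_itvl.
have L x : exists2 l, 0 <= l <= M & Phi n x @[n --> U] --> l.
  exact: ultra_cvg_segment.
have [L' /all_and2[L0M PhiL]] : {L' & forall x, 0 <= L' x <= M /\ Phi n x @[n --> U] --> L' x}.
  apply: (@choice R R (fun x l => 0 <= l <= M /\ Phi n x @[n --> U] --> l)) => x.
  by have [l] := L x; exists l.
have PU : ProperFilter U := @ultra_proper _ _ UU.
have ndL : {homo L' : x y / x <= y}.
  move=> x y xy; apply: (ler_cvg_to (PhiL x) (PhiL y)).
  apply: nearW => n; rewrite /Phi fine_le ?fin_num_measure//.
  by rewrite le_measure ?inE//; apply: subset_itvl; rewrite bnd_simp.
have Lneg x : x < 0 -> L' x = 0.
  move=> x0; apply: (cvg_unique _ (PhiL x)) => //.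
  rewrite (_ : Phi^~ x = fun=> 0); first exact: cvg_cst.
  by apply/funext => n; rewrite /Phi set_itv_ge ?measure0// bnd_simp -ltNge.
have [Z [Zneg ZM LZ ZL]] := measure_of_limit_cdf ndL L0M Lneg.
exists Z, U; split=> // s s0; apply/cvgrPdist_le => e e0.
have M0 : 0 <= M by case/andP: (L0M 0) => /le_trans; apply.
(* Four quarters of [e]: the step errors under [nu n] and under [Z], the convergence of the step
   sums, and the gap between [L'] and [Z]. *)
have [N N0 NM] : exists2 N, (0 < N)%N & (N%:R * s)^-1 * M <= e / 4.
  exists (Num.truncn (M / s / (e / 4))).+1 => //.
  set n := (Num.truncn _).+1; have n0 : 0 < n%:R :> R by rewrite ltr0n.
  have -> : (n%:R * s)^-1 * M = M / s / n%:R by field; rewrite !gt_eqF.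
  rewrite ler_pdivrMr// -ler_pdivrMl; last by lra.
  by rewrite mulrC ltW// truncnS_gt.
have Ns : 0 <= (N%:R * s)^-1 by rewrite invr_ge0 mulr_ge0// ltW.
have stepM mu : halfline_mass mu <= M ->
  `|halfline_integral mu (fun x => (s + x)^-1) -
    (N%:R * s)^-1 * \sum_(i < N) fine (mu `[0, step_point s N i]%classic)| <= e / 4.
  move=> muM; apply: le_trans (halfline_integral_kernel_step s0 N0 mu) _.
  by apply: le_trans NM; rewrite ler_wpM2l.
pose SL := (N%:R * s)^-1 * \sum_(i < N) L' (step_point s N i).
have SPhi : (N%:R * s)^-1 * \sum_(i < N) Phi n (step_point s N i) @[n --> U] --> SL.
  apply: cvgM; first exact: cvg_cst.
  exact: (@cvg_sum_ord R nat U _ N (fun i n => Phi n (step_point s N i))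
    (fun i => L' (step_point s N i)) (fun i => PhiL _)).
pose SZ := (N%:R * s)^-1 * \sum_(i < N) fine (Z `[0, step_point s N i]%classic).
have SLZ : SL <= SZ.
  by rewrite ler_wpM2l// ler_sum// => i _; rewrite LZ// step_point_ge0.
have SZL : SZ - SL <= e / 4.
  rewrite -mulrBr; apply: le_trans NM; rewrite ler_wpM2l// -sumrB.
  (* Each value of [Z] at step [i + 1] is at most [L'] at step [i], so the sum of all gaps stays
     below [M] whatever [N] is, and the prefactor makes it small. *)
  have H n : (n < N)%N -> \sum_(i < n.+1) (fine (Z `[0, step_point s N i]%classic) -
      L' (step_point s N i)) <= M - L' (step_point s N n).
    elim: n => [|n IH] nN.
      rewrite big_ord_recr big_ord0 /= add0r lerD2r.
      apply: (le_trans (ZL _ (step_point s N 0 + 1) _ _)).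
      - by rewrite step_point_ge0.
      - by rewrite ltrDl.
      - by case/andP: (L0M (step_point s N 0 + 1)).
    rewrite big_ord_recr/=; have := IH (ltnW nN).
    have := ZL _ _ (step_point_ge0 s0 nN) (step_point_decr s0 N0 n); lra.
  have NE : N = N.-1.+1 by rewrite prednK.
  have := H N.-1; rewrite -NE => /(_ (leqnn _)) /le_trans; apply.
  by case/andP: (L0M (step_point s N N.-1)); lra.
have e4 : 0 < e / 4 by lra.
have := stepM _ ZM; rewrite -/SZ => HZ.
move/cvgrPdist_le: SPhi => /(_ _ e4); apply: filterS => n.
by have := stepM _ (nuM n); move: HZ; rewrite !ler_norml; lra.
Qed.

End helly.

(** * Integrals against the zero measures *)

Section zeros_measure_integral.
Context {R : realType}.
Local Notation C := (complexC R).
Local Notation Re := complex.Re.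
Local Notation Im := complex.Im.
Local Notation halfline := (`[0 : R, +oo[%classic).
Implicit Types (w : {posnum R}) (p : {poly R}).

Definition nonpositive_zeros p := forall z, z \in complex_zeros p -> Re z <= 0.

Lemma complex_zerosE p : map_poly (@toC R) p =
  lead_coef (map_poly (@toC R) p) *: \prod_(z <- complex_zeros p) ('X - z%:P).
Proof. by rewrite /complex_zeros; case: closed_field_poly_normal. Qed.

Lemma size_complex_zeros p : p != 0 -> size (complex_zeros p) = (size p).-1.
Proof.
move=> p0; have := congr1 (fun q : {poly C} => size q) (complex_zerosE p).
rewrite size_map_poly size_scale ?size_prod_XsubC; first by move=> ->.
by rewrite lead_coef_eq0 map_poly_eq0.
Qed.

Lemma zeros_measure_neg w p : nonpositive_zeros p ->
  supported_on_nonneg (zeros_measure w p).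
Proof.
move=> pz.
suff : ((w%:num^-1)%:E * \sum_(i < size (complex_zeros p))
    \d_(- Re (nth 0 (complex_zeros p) i))%R (`]-oo, (0 : R)%R[%classic) = 0)%E by [].
rewrite big1 ?mule0// => i _.
rewrite diracE mem_setE in_itv/= oppr_lt0 ltNge.
by rewrite pz//; apply: mem_nth.
Qed.

Lemma halfline_integral_zeros_ge0 w p (f : R -> R) : nonpositive_zeros p ->
  measurable_fun halfline f -> (forall x : R, 0 <= x -> 0 <= f x) ->
  halfline_integral (zeros_measure w p) f =
  w%:num^-1 * \sum_(z <- complex_zeros p) f (- Re z).
Proof.
move=> pz mf f0; rewrite /halfline_integral /Rintegral.
have f0' (x : R) : halfline x -> (0 <= (f x)%:E)%E.
  by rewrite /= in_itv/= andbT lee_fin => /f0.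
have mfE : measurable_fun halfline (EFin \o f) by apply/measurable_EFinP.
rewrite /zeros_measure ge0_integral_mscale// ge0_integral_measure_sum//.
rewrite (eq_bigr (fun i : 'I__ => (f (- Re (nth 0 (complex_zeros p) i)))%:E)).
  by rewrite sumEFin -EFinM /= (big_nth 0) big_mkord.
move=> i _; rewrite integral_dirac// diracE mem_setE in_itv/= andbT oppr_ge0.
by rewrite pz ?mul1e//; apply: mem_nth.
Qed.

(** Adding the bound [K] reduces the claim to nonnegative functions, for which integrals against
    scaled sums of measures split; the contribution of [K] then cancels. *)
Lemma halfline_integral_zeros w p (f : R -> R) : nonpositive_zeros p ->
  bounded_measurable f ->
  halfline_integral (zeros_measure w p) f =
  w%:num^-1 * \sum_(z <- complex_zeros p) f (- Re z).
Proof.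
move=> pz bf; case: (bf) => mf [K fK].
have bK := @bounded_measurable_cst R K.
have := halfline_integral_lin (zeros_measure w p) 1 1 bf bK.
have [mfK _] := bounded_measurable_lin 1 1 bf bK.
have fK0 (x : R) : 0 <= x -> 0 <= 1 * f x + 1 * K.
  by move=> /fK; rewrite ler_norml; lra.
have [K0|K0] := leP 0 K; last first.
  by have := fK 0 (lexx _); have := normr_ge0 (f 0); lra.
rewrite (halfline_integral_zeros_ge0 w pz mfK fK0).
rewrite (@halfline_integral_zeros_ge0 w p (fun=> K))//; 
under eq_bigr do rewrite !mul1r.
by rewrite !mul1r big_split/= mulrDr => /addIr.
Qed.

Lemma halfline_mass_zeros w p : p != 0 -> nonpositive_zeros p ->
  halfline_mass (zeros_measure w p) = (size p).-1%:R / w%:num.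
Proof.
move=> p0 pz; have := halfline_integral_zeros w pz (@bounded_measurable_cst R 1).
rewrite {1}/halfline_integral Rintegral_cst// mul1r -/(halfline_mass _) => ->.
by rewrite big_const_seq count_predT iter_addr addr0 size_complex_zeros// mulrC.
Qed.

End zeros_measure_integral.

(** * Generating polynomials and Laplace transforms *)

Section generating_function.
Context {R : realType} d (T : measurableType d) (P : probability T R) (X : {RV P >-> R}).
Variable G : {poly R}.
Hypothesis X_nat : forall o, X o \is a Num.nat.
Hypothesis X_bounded : exists M : R, {ae P, forall o, X o <= M}.
Hypothesis G_pgf : forall t : R,
  ('E_P[(fun o => t ^+ Num.truncn (X o))%R])%E = (G.[t])%:E.
Local Notation C := (complexC R).
Local Notation Re := complex.Re.
Local Notation Im := complex.Im.
Local Notation normc := Normc.normc.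

(** Leaving [h] arbitrary lets the same finite law compute the total mass, the generating function,
    and the real and imaginary parts of the Laplace transform. *)
Lemma integral_nat_valued : exists (N : nat) (p : nat -> R), (forall k, 0 <= p k) /\
  forall h : nat -> R, (\int[P]_o (h (Num.truncn (X o)))%:E)%E = (\sum_(k < N) h k * p k)%:E.
Proof.
have [M XM] := X_bounded.
pose A k := X @^-1` [set k%:R : R].
have mA k : measurable (A k).
  by rewrite -[A k]setTI; apply: measurable_funP => //; exact: measurable_set1.
have XE o : (Num.truncn (X o))%:R = X o by rewrite truncnK// X_nat.
have mh (h : nat -> R) : measurable_fun setT (fun o => h (Num.truncn (X o))).
  move=> _ Y mY; rewrite setTI.
  have -> : (fun o => h (Num.truncn (X o))) @^-1` Y = \bigcup_(k in [set k | Y (h k)]) A k.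
    apply/seteqP; split=> o /=.
      by move=> Yo; exists (Num.truncn (X o)) => //; rewrite /A/= XE.
    by move=> [k /= Yk]; rewrite /A /= => ->; rewrite natrK.
  by apply: bigcup_measurable.
pose N := (Num.truncn M).+1.
exists N, (fun k => fine (P (A k))); split; first by move=> k; rewrite fine_ge0.
move=> h.
pose g o := \sum_(k < N) h k * \1_(A k) o.
have mg : measurable_fun setT g.
  by apply: measurable_sum => k; apply: measurable_funM => //; exact: measurable_indic.
transitivity (\int[P]_o (g o)%:E)%E.
  apply: ae_eq_integral => //; [exact/measurable_EFinP|exact/measurable_EFinP|].
  apply: filterS XM => o XoM _ /=; congr EFin.
  have oN : (Num.truncn (X o) < N)%N by rewrite /N ltnS le_truncn.
  rewrite /g (bigD1 (Ordinal oN))//= indicE mem_set ?mulr1; last by rewrite /A/= XE.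
  rewrite big1 ?addr0// => k /eqP kX; rewrite indicE memNset ?mulr0//.
  by rewrite /A/= => XoE; apply: kX; apply: val_inj => /=; rewrite XoE natrK.
under eq_integral do rewrite /g -sumEFin.
rewrite integral_sum//; last first.
  move=> k; apply: measurable_bounded_integrable => //.
  - by rewrite (le_lt_trans (probability_le1 _ _))// ltry.
  - by apply: measurable_funM => //; exact: measurable_indic.
  exists `|h k|; split; first exact: num_real.
  move=> K hK o _ /=; rewrite normrM (le_trans _ (ltW hK))// ler_piMr// indicE.
  by rewrite ger0_norm ?lern1 ?leq_b1.
rewrite -sumEFin; apply: eq_bigr => k _.
under eq_integral do rewrite EFinM.
rewrite integralZl//; last first.
  apply: measurable_bounded_integrable => //.
    by rewrite (le_lt_trans (probability_le1 _ _))// ltry.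
  exists 1; split; first exact: num_real.
  move=> K K1 o _ /=; rewrite (le_trans _ (ltW K1))// indicE.
  by rewrite ger0_norm ?lern1 ?leq_b1.
by rewrite integral_indic// setIT EFinM fineK// fin_num_measure.
Qed.

Lemma pgf_coef : exists (N : nat) (p : nat -> R), [/\ forall k, 0 <= p k,
  \sum_(k < N) p k = 1, G = \sum_(k < N) p k *: 'X^k &
  forall h : nat -> R, (\int[P]_o (h (Num.truncn (X o)))%:E)%E = (\sum_(k < N) h k * p k)%:E].
Proof.
have [N [p [p0 hE]]] := integral_nat_valued; exists N, p; split=> //.
  have := hE (fun=> 1); rewrite integral_cst// mul1e.
  move=> /(etrans (esym (probability_setT P))) [->].
  by under eq_bigr do rewrite mul1r.
apply/eqP; rewrite -subr_eq0; apply/eqP; set q := G - _.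
(* [q] vanishes at every natural number, hence at [size q] distinct points, more than a nonzero
   polynomial of that size allows. *)
apply: (@roots_geq_poly_eq0 _ _ [seq i%:R | i <- iota 0 (size q)]).
- apply/allP => _ /mapP[i _ ->]; rewrite rootE /q hornerD hornerN.
  have := G_pgf i%:R; rewrite unlock hE => -[<-].
  rewrite horner_sum subr_eq0; apply/eqP/eq_bigr => k _.
  by rewrite hornerZ hornerXn mulrC.
- by rewrite map_inj_uniq ?iota_uniq// => i j /eqP; rewrite eqr_nat => /eqP.
- by rewrite size_map size_iota.
Qed.

(** This serves twice: it makes [G] nonzero and it excludes positive zeros. *)
Lemma pgf_gt0 t : 0 < t -> 0 < G.[t].
Proof.
move=> t0; have [N [p [p0 p1 -> _]]] := pgf_coef.
rewrite horner_sum lt_def sumr_ge0 ?andbT; last first.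
  by move=> k _; rewrite hornerZ hornerXn mulr_ge0// exprn_ge0// ltW.
apply/negP; rewrite psumr_eq0; last first.
  by move=> k _; rewrite hornerZ hornerXn mulr_ge0// exprn_ge0// ltW.
move=> /allP pk; have := oner_neq0 R; rewrite -p1 big1 ?eqxx// => k _.
have := pk k (mem_index_enum _); rewrite hornerZ hornerXn mulf_eq0.
by rewrite [_ ^+ _ == 0]gt_eqF ?exprn_gt0// orbF => /eqP.
Qed.

Lemma laplace_pgf z : laplace X z = (map_poly (@toC R) G).[cexp z].
Proof.
have [N [p [_ _ -> hE]]] := pgf_coef.
have E o : cexp (z * toC (X o)) = cexp z ^+ Num.truncn (X o).
  by rewrite -cexpMn -(rmorph_nat (@toC R)) truncnK// X_nat.
have GE : map_poly (@toC R) (\sum_(k < N) p k *: 'X^k) = \sum_(k < N) toC (p k) *: 'X^k.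
  by rewrite raddf_sum; apply: eq_bigr => k _; rewrite /= map_polyZ map_polyXn.
rewrite GE horner_sum /laplace (funext E) /cintegral /Rintegral.
apply: complexP; rewrite sum_complexE [LHS]/=.
  rewrite (hE (fun k => Re (cexp z ^+ k))) [LHS]/=; apply: eq_bigr => k _.
  by rewrite hornerZ hornerXn ReM Re_toC Im_toC mul0r subr0 mulrC.
rewrite (hE (fun k => Im (cexp z ^+ k))) [LHS]/=; apply: eq_bigr => k _.
by rewrite hornerZ hornerXn ImM Re_toC Im_toC mul0r addr0 mulrC.
Qed.

Hypothesis G_real_zeros : only_real_zeros G.

Lemma pgf_zerosE z : z \in complex_zeros G -> z = toC (Re z) /\ Re z <= 0.
Proof.
move=> zG; have rz : root (map_poly (@toC R) G) z.
  rewrite complex_zerosE rootZ ?root_prod_XsubC//.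
  rewrite lead_coef_eq0 map_poly_eq0; apply/eqP => G0.
  by have := pgf_gt0 (ltr01); rewrite G0 horner0 ltxx.
have zE : z = toC (Re z) by apply: complexP => //; rewrite (G_real_zeros rz).
split=> //; rewrite leNgt; apply/negP => /pgf_gt0.
by move: rz; rewrite zE fmorph_root rootE => /eqP ->; rewrite ltxx.
Qed.

Lemma normc_laplace z : normc (laplace X z) =
  `|lead_coef G| * \prod_(r <- complex_zeros G) normc (cexp z + toC (- Re r)).
Proof.
rewrite laplace_pgf complex_zerosE hornerZ Normc.normcM; congr (_ * _).
  rewrite lead_coef_map_eq ?normc_toC// fmorph_eq0 lead_coef_eq0; apply/eqP => G0.
  by have := pgf_gt0 ltr01; rewrite G0 horner0 ltxx.
rewrite horner_prod !big_seq.
apply: (big_ind2 (fun x y => normc x = y)) => [|x _ y _ <- <-|r rG].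
  exact: Normc.normc1.
  exact: Normc.normcM.
by rewrite hornerXsubC [in LHS](pgf_zerosE rG).1 raddfN.
Qed.

End generating_function.

(** * Increments of the logarithm of the modulus *)

Section logarithmic_derivative.
Context {R : realType}.
Local Notation C := (complexC R).
Local Notation Re := complex.Re.
Local Notation Im := complex.Im.
Local Notation normc := Normc.normc.

(** The field is generic so that the expansion applies to [phi] over [C] and to [expR], [sin], [cos]
    over [R]. *)
Lemma derivable_near (K : numFieldType) (f : K -> K) (z : K) : derivable f z 1 ->
  forall e : K, 0 < e ->
  \forall h \near (0 : K), `|f (z + h) - f z - h * 'D_1 f z| <= e * `|h|.
Proof.
move=> df e e0.
have /cvgrPdist_le/(_ _ e0) : h^-1 *: (f (h *: 1 + z) - f z) @[h --> 0^'] --> 'D_1 f z.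
  exact: df.
rewrite near_withinE; apply: filterS => h H.
have [->|h0] := eqVneq h 0; first by rewrite addr0 subrr mul0r subrr normr0 mulr0.
have := H h0; rewrite -(ler_pM2r (x := `|h|)) ?normr_gt0// -normrM.
by rewrite mulrBl -[_ *: _ in X in X -> _]/(_ * _) [_^-1 * _ * _]mulrAC mulVf// mul1r
  -[_ *: _ in X in X -> _]/(_ * _) mulr1 [h + z]addrC distrC [h * _]mulrC.
Qed.

(** Write [ln |1 + u|] as half of [ln (1 + v)], with [v] at least [-1/2], and use
    [v - 2 v^2 <= ln (1 + v) <= v]. From [|v| <= 9/4 |u|] the error is at most
    [(81/16 - 1/2) |u|^2], rounded up to 5. *)
Lemma ln_normc1D (u : C) : normc u <= 4^-1 ->
  `|ln (normc (1 + u)) - Re u| <= 5 * normc u ^+ 2.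
Proof.
move=> u4; have u0 := normc_ge0 u; have := le_Re_normc u; rewrite ler_norml => /andP[uN up].
pose v := 2 * Re u + normc u ^+ 2.
have vE : normc (1 + u) ^+ 2 = 1 + v.
  by rewrite /v !sqr_normc ReD ImD Re1 Im1; ring.
have v2 : - 2^-1 <= v by have := sqr_ge0 (normc u); rewrite /v; lra.
have v1 : 0 < 1 + v by lra.
have n0 : 0 < normc (1 + u).
  by rewrite lt_def normc_ge0 andbT; apply/eqP => n0; move: v1; rewrite -vE n0 expr0n ltxx.
have lnE : ln (1 + v) = 2 * ln (normc (1 + u)).
  by rewrite -vE lnXn// mulr_natl.
have lev : ln (1 + v) <= v by apply: le_ln1Dx; lra.
have gev : v - 2 * v ^+ 2 <= ln (1 + v).
  have H : ln (1 + v)^-1 <= (1 + v)^-1 - 1.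
    by rewrite -[X in ln X](addrNK 1) addrC le_ln1Dx// ltrBDr addNr invr_gt0.
  rewrite lnV ?posrE// in H.
  have H2 : 1 - (1 + v)^-1 >= v - 2 * v ^+ 2.
    rewrite -subr_ge0.
    have -> : 1 - (1 + v)^-1 - (v - 2 * v ^+ 2) = v ^+ 2 * (1 + 2 * v) / (1 + v) by field; lra.
    by rewrite divr_ge0 ?(ltW v1)// mulr_ge0 ?sqr_ge0//; lra.
  lra.
have v_le : v ^+ 2 <= (81 / 16) * normc u ^+ 2.
  have : `|v| <= 9 / 4 * normc u.
    have : normc u ^+ 2 <= 4^-1 * normc u by rewrite expr2 ler_wpM2r.
    by have := sqr_ge0 (normc u); rewrite /v ler_norml; lra.
  move=> H; rewrite -(real_normK (num_real v)).
  have -> : 81 / 16 * normc u ^+ 2 = (9 / 4 * normc u) ^+ 2 by field.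
  by apply: lerXn2r; rewrite ?nnegrE// mulr_ge0.
have := sqr_ge0 (normc u); rewrite ler_norml; rewrite /v in lev gev v_le *; lra.
Qed.

Lemma Re_toCM (t : R) (y : C) : Re (toC t * y) = t * Re y.
Proof. by rewrite ReM /= mul0r subr0. Qed.

Lemma sum_le_size (r : seq R) (f : R -> R) (b : R) :
  (forall x, x \in r -> f x <= b) -> \sum_(x <- r) f x <= (size r)%:R * b.
Proof.
elim: r => [|x r IH] H; first by rewrite big_nil mul0r.
rewrite big_cons/= -natr1 mulrDl mul1r addrC lerD//; last by apply: H; rewrite mem_head.
by apply: IH => y yr; apply: H; rewrite in_cons yr orbT.
Qed.

Lemma normc_sum (r : seq R) (f : R -> C) :
  normc (\sum_(x <- r) f x) <= \sum_(x <- r) normc (f x).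
Proof.
elim: r => [|x r IH]; first by rewrite !big_nil Normc.normc0.
by rewrite !big_cons (le_trans (normcD _ _))// lerD2l.
Qed.

Lemma ln_prod (r : seq R) (f : R -> R) : (forall x, x \in r -> 0 < f x) ->
  0 < \prod_(x <- r) f x /\ ln (\prod_(x <- r) f x) = \sum_(x <- r) ln (f x).
Proof.
elim: r => [|x r IH] H; first by rewrite !big_nil ln1.
have fx : 0 < f x by apply: H; rewrite mem_head.
have [|p0 pE] := IH; first by move=> y yr; apply: H; rewrite in_cons yr orbT.
by rewrite !big_cons mulr_gt0// lnM ?posrE// pE.
Qed.

(** A nonnegative shift of a point of the right half-plane moves it away from 0. This is the source
    of all the bounds that do not depend on the zeros. *)
Lemma le_normc_cexpD (z : C) (x : R) : 0 < Re (cexp z) -> 0 <= x ->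
  normc (cexp z) <= normc (cexp z + toC x).
Proof.
move=> z0 x0; rewrite -(@ler_pXn2r _ 2)// ?nnegrE ?normc_ge0//.
rewrite !sqr_normc ReD ImD Re_toC Im_toC addr0 lerD2r.
by apply: lerXn2r; rewrite ?nnegrE ?addr_ge0 ?(ltW z0)// lerDl.
Qed.

Section increments.
Variables (rts : seq R) (z : C).
Hypothesis rts_ge0 : forall x, x \in rts -> 0 <= x.
Hypothesis z_gt0 : 0 < Re (cexp z).
Local Notation q := (fun x : R => cexp z / (cexp z + toC x)).

Lemma cexpD_neq0 x : x \in rts -> cexp z + toC x != 0.
Proof.
move=> /rts_ge0 x0; rewrite -normc_gt0 (lt_le_trans _ (le_normc_cexpD z_gt0 x0))//.
by rewrite normc_cexp expR_gt0.
Qed.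

Lemma normc_ratio_le1 x : x \in rts -> normc (q x) <= 1.
Proof.
move=> xr; have x0 := rts_ge0 xr; have := cexpD_neq0 xr.
rewrite -normc_gt0 => n0; rewrite Normc.normcM Normc.normcV ler_pdivrMr// mul1r.
exact: le_normc_cexpD.
Qed.

(** The increments are multiplicative in [cexp h], so the small parameter is [cexp h - 1];
    [exp_direction] later compares it with [h]. *)
Lemma cexpD_increment (h : C) x : x \in rts ->
  cexp (z + h) + toC x = (cexp z + toC x) * (1 + q x * (cexp h - 1)).
Proof.
move=> /cexpD_neq0 n0; rewrite cexpD mulrDr mulr1 mulrA [_ * (_ / _)]mulrC divfK//.
by ring.
Qed.

Lemma normc_ratioM_le (h : C) x : normc (cexp h - 1) <= 4^-1 -> x \in rts ->
  normc (q x * (cexp h - 1)) <= 4^-1.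
Proof.
by move=> h4 /normc_ratio_le1 qx; rewrite Normc.normcM (le_trans _ h4)// ler_piMl// normc_ge0.
Qed.

Lemma normc_ratio1D_gt0 (h : C) x : normc (cexp h - 1) <= 4^-1 -> x \in rts ->
  0 < normc (1 + q x * (cexp h - 1)).
Proof.
move=> h4 xr; rewrite normc_gt0; apply/eqP => H.
have := normc_ratioM_le h4 xr; have -> : q x * (cexp h - 1) = - 1.
  by rewrite -[LHS](addKr 1) H addr0.
by rewrite normcN Normc.normc1; lra.
Qed.

Lemma normc_cexpD_gt0 (h : C) x : normc (cexp h - 1) <= 4^-1 -> x \in rts ->
  0 < normc (cexp (z + h) + toC x).
Proof.
move=> h4 xr; rewrite cexpD_increment// Normc.normcM mulr_gt0 ?normc_ratio1D_gt0//.
by rewrite normc_gt0 cexpD_neq0.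
Qed.

Lemma ln_prod_increment (h : C) : normc (cexp h - 1) <= 4^-1 ->
  `|ln (\prod_(x <- rts) normc (cexp (z + h) + toC x)) -
    ln (\prod_(x <- rts) normc (cexp z + toC x)) -
    Re ((cexp h - 1) * \sum_(x <- rts) q x)| <=
  (size rts)%:R * (5 * normc (cexp h - 1) ^+ 2).
Proof.
move=> rho4.
have f1 x : x \in rts -> 0 < normc (1 + q x * (cexp h - 1)) by exact: normc_ratio1D_gt0.
have f0 x : x \in rts -> 0 < normc (cexp z + toC x).
  by move=> /cexpD_neq0; rewrite normc_gt0.
have fh x : x \in rts -> 0 < normc (cexp (z + h) + toC x) by exact: normc_cexpD_gt0.
rewrite (ln_prod fh).2 (ln_prod f0).2 mulr_sumr sum_complexE -!sumrB.
apply: (le_trans (ler_norm_sum _ _ _)).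
apply: sum_le_size => x xr.
rewrite cexpD_increment// Normc.normcM lnM ?posrE ?f0 ?f1// [_ + ln _]addrC addrK.
rewrite [(_ - 1) * _]mulrC.
apply: (le_trans (ln_normc1D (normc_ratioM_le rho4 xr))); rewrite ler_wpM2l//.
apply: lerXn2r; rewrite ?nnegrE ?normc_ge0// Normc.normcM ler_piMl ?normc_ge0//.
exact: normc_ratio_le1.
Qed.

End increments.

Lemma derivableC_near (f : C -> C) (z : C) : derivable f z 1 -> forall e : R, 0 < e ->
  \forall h \near (0 : C), normc (f (z + h) - f z - h * derive1 f z) <= e * normc h.
Proof.
move=> df e e0; have eC : (0 : C) < toC e by rewrite ltcE/= eqxx.
have := derivable_near df eC; apply: filterS => h.
by rewrite !normcE -rmorphM/= lecE/= derive1E => /andP[].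
Qed.

(* [1] and ['i] are unit directions; the second part is [exp(te) = 1 + te + o(t)]. *)
Definition exp_direction (e : C) := normc e = 1 /\ forall eta : R, 0 < eta ->
  \forall t \near (0 : R)^'+, normc (cexp (toC t * e) - 1 - toC t * e) <= eta * t.

Lemma exp_direction1 : exp_direction 1.
Proof.
split=> [|eta eta0]; first exact: Normc.normc1.
have H := derivable_near (@derivable_expR R 0) eta0.
rewrite derive_val expR0 in H.
near=> t; have t0 : 0 < t by near: t; exact: nbhs_right_gt.
have : `|expR (0 + t) - 1 - t * 1| <= eta * `|t| by near: t; exact: cvg_within H.
rewrite add0r mulr1 (gtr0_norm t0) -normc_toC !rmorphB rmorph1 !mulr1.
congr (normc (_ - _ - _) <= _); apply: complexP => /=.
  by rewrite cos0 mulr1.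
by rewrite sin0 mulr0.
Unshelve. all: by end_near. Qed.

Lemma exp_directioni : exp_direction (Complex 0 1).
Proof.
split=> [|eta eta0]; first by rewrite /= expr0n expr1n add0r sqrtr1.
have eta20 : 0 < eta / 2 by rewrite divr_gt0.
have Hs := derivable_near (@derivable_sin R 0) eta20.
have Hc := derivable_near (@derivable_cos R 0) eta20.
rewrite derive_val sin0 cos0 in Hs; rewrite derive_val sin0 cos0 in Hc.
near=> t; have t0 : 0 < t by near: t; exact: nbhs_right_gt.
have : `|sin (0 + t) - 0 - t * 1| <= eta / 2 * `|t| by near: t; exact: cvg_within Hs.
have : `|cos (0 + t) - 1 - t * - 0| <= eta / 2 * `|t| by near: t; exact: cvg_within Hc.
rewrite !add0r oppr0 mulr0 mulr1 !subr0 (gtr0_norm t0) => H1 H2.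
rewrite (le_trans (normc_le_ReIm _))// (splitr (eta * t)).
have E : toC t * Complex 0 1 = Complex 0 t.
  by apply: complexP => /=; rewrite ?mulr0 ?mul0r ?mulr1 ?subr0 ?addr0.
rewrite E !ReB !ImB Re1 Im1 /= expR0 !mul1r !subr0 mulrAC lerD//.
by rewrite addr0 in H2.
Unshelve. all: by end_near. Qed.

(** * Limits of the logarithmic derivatives *)

Section limit_of_logarithmic_derivatives.
Variables (w c : nat -> R) (rts : nat -> seq R) (M : R) (phi : C -> C) (l : C -> R) (z : C).
Hypothesis w_gt0 : forall n, 0 < w n.
Hypothesis w_cvg : w n @[n --> \oo] --> +oo.
Hypothesis c_gt0 : forall n, 0 < c n.
Hypothesis rts_ge0 : forall n x, x \in rts n -> 0 <= x.
Hypothesis rts_size : forall n, (size (rts n))%:R <= M * w n.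
Hypothesis phi_derivable : derivable phi z 1.
Hypothesis z_gt0 : 0 < Re (cexp z).

(** It will be the modulus of the Laplace transform at [y], with [c n] the absolute leading
    coefficient and [l] the modulus of [Psi]. *)
Let modulus n y := c n * \prod_(x <- rts n) normc (cexp y + toC x).

Hypothesis modulus_cvg : \forall y \near z, 0 < l y /\
  modulus n y / expR (w n * Re (phi y)) @[n --> \oo] --> l y.

Let log_modulus n y := ln (modulus n y) / w n.

(** For the zeros of [G n] this is the derivative in [z] of [log (G_n (e^z)) / w_n], that is [- e^z]
    times the Stieltjes transform of the zero measure at [- e^z]. *)
Let g n := toC (w n)^-1 * \sum_(x <- rts n) (cexp z / (cexp z + toC x)).

(** After taking logarithms the limit [l] only contributes [ln (l y) / w n], which vanishes because
    [l y > 0] and [w] diverges. *)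
Lemma log_modulus_cvg : \forall y \near z,
  log_modulus n y @[n --> \oo] --> Re (phi y).
Proof.
apply: filterS modulus_cvg => y [ly ml].
have wV : (w n)^-1 @[n --> \oo] --> 0 by apply/gtr0_cvgV0 => //; exact: nearW.
have lnl : ln (modulus n y / expR (w n * Re (phi y))) @[n --> \oo] --> ln (l y).
  by apply: continuous_cvg ml; exact: continuous_ln.
have : Re (phi y) + ln (modulus n y / expR (w n * Re (phi y))) * (w n)^-1 @[n --> \oo] -->
    Re (phi y) + ln (l y) * 0.
  by apply: cvgD; [exact: cvg_cst|exact: cvgM].
rewrite mulr0 addr0; apply: cvg_trans; apply: near_eq_cvg.
near=> n.
have : 0 < modulus n y / expR (w n * Re (phi y)) by near: n; exact: (cvgr_gt _ ml _ ly).
rewrite pmulr_lgt0 ?invr_gt0 ?expR_gt0// => m0.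
rewrite ln_div ?posrE ?expR_gt0// expRK /log_modulus; field.
by rewrite gt_eqF.
Unshelve. all: by end_near. Qed.

Let M_ge0 : 0 <= M.
Proof. by rewrite -(pmulr_lge0 _ (w_gt0 0)) (le_trans _ (rts_size 0)). Qed.

Lemma normc_logder_le n : normc (g n) <= M.
Proof.
rewrite Normc.normcM normc_toC ger0_norm ?invr_ge0 ?(ltW (w_gt0 n))//.
rewrite ler_pdivrMl// mulrC; apply: le_trans (rts_size n).
apply: (le_trans (normc_sum _ _)); rewrite -[leRHS]mulr1.
by apply: sum_le_size => x; apply: normc_ratio_le1 => //; exact: rts_ge0.
Qed.

Lemma log_modulus_increment n h : normc (cexp h - 1) <= 4^-1 ->
  `|log_modulus n (z + h) - log_modulus n z - Re ((cexp h - 1) * g n)| <=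
  M * (5 * normc (cexp h - 1) ^+ 2).
Proof.
move=> h4; have := ln_prod_increment (@rts_ge0 n) z_gt0 h4.
have P0 y : (forall x, x \in rts n -> 0 < normc (cexp y + toC x)) ->
    ln (modulus n y) = ln (c n) + ln (\prod_(x <- rts n) normc (cexp y + toC x)).
  by move=> H; rewrite /modulus lnM ?posrE//; exact: (ln_prod H).1.
rewrite /log_modulus !P0; last 2 first.
- by move=> x xr; rewrite normc_gt0 (cexpD_neq0 (@rts_ge0 n)).
- by move=> x xr; rewrite (normc_cexpD_gt0 (@rts_ge0 n)).
move=> H; have wn := w_gt0 n.
have -> : Re ((cexp h - 1) * g n) =
    Re ((cexp h - 1) * \sum_(x <- rts n) (cexp z / (cexp z + toC x))) / w n.
  by rewrite /g mulrCA Re_toCM mulrC.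
rewrite -!mulrBl normrM [X in _ * X]gtr0_norm ?invr_gt0// ler_pdivrMr//.
rewrite opprD addrACA subrr add0r; apply: (le_trans H).
by rewrite mulrAC ler_wpM2r// mulr_ge0// sqr_ge0.
Qed.

Lemma Re_logder_cvg (e : C) : exp_direction e ->
  Re (e * g n) @[n --> \oo] --> Re (e * derive1 phi z).
Proof.
move=> [e1 He]; apply/cvgrPdist_le => eps eps0.
(* Four errors of size [eta * t] occur: two limits of [log_modulus], the expansion of [phi], and the
   quadratic remainder. Replacing [cexp (t e) - 1] by [t e] costs [M] more, since
   [normc (g n) <= M]. *)
pose eta := Num.min 1 (eps / (4 + M)).
have M4 : 0 < 4 + M by rewrite ltr_pwDl.
have eta0 : 0 < eta by rewrite lt_min ltr01 divr_gt0.
have eta1 : eta <= 1 by rewrite ge_min lexx.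
have etaE : eta * (4 + M) <= eps by rewrite -ler_pdivlMr// ge_min lexx orbT.
have dir P : (\forall h \near (0 : C), P h) -> \forall t \near (0 : R)^'+, P (toC t * e).
  move=> /nearC[d d0 H]; near=> t; apply: H; rewrite subr0 Normc.normcM e1 mulr1 normc_toC.
  rewrite gtr0_norm; last by near: t; exact: nbhs_right_gt.
  by near: t; exact: nbhs_right_lt.
have shift P : (\forall y \near z, P y) -> \forall h \near (0 : C), P (z + h).
  move=> /nearC[d d0 H]; apply/nearC; exists d => // h; rewrite subr0 => hd.
  by apply: H; rewrite addrC addKr.
have M20 : 0 < 20 * M + 1 by rewrite ltr_wpDl// mulr_ge0.
(* The step [t] is fixed before [n] varies, which is legitimate because the bounds on the increments
   are uniform in [n]. *)
near (0 : R)^'+ => t.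
have t0 : 0 < t by near: t; exact: nbhs_right_gt.
have rho1 : normc (cexp (toC t * e) - 1 - toC t * e) <= eta * t.
  by near: t; exact: He.
have phi1 : normc (phi (z + toC t * e) - phi z - toC t * e * derive1 phi z) <=
    eta * normc (toC t * e).
  by near: t; apply: (dir _ (derivableC_near phi_derivable eta0)).
have cvt : log_modulus n (z + toC t * e) @[n --> \oo] --> Re (phi (z + toC t * e)).
  by near: t; apply: (dir _ (shift _ log_modulus_cvg)).
(* As [normc rho <= 2 * t], this gives the [1/4] required by the logarithmic expansion; the next
   bound makes [5 M (2 t)^2 = 20 M t^2] at most [eta * t]. *)
have t8 : t < 8^-1 by near: t; apply: nbhs_right_lt; lra.
have tM : t < eta / (20 * M + 1) by near: t; apply: nbhs_right_lt; rewrite divr_gt0.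
have nte : normc (toC t * e) = t by rewrite Normc.normcM e1 mulr1 normc_toC gtr0_norm.
rewrite nte in phi1.
set rho := cexp (toC t * e) - 1 in rho1.
have et : eta * t <= t by rewrite ler_piMl// ltW.
have rho2 : normc rho <= 2 * t.
  have := normcD (rho - toC t * e) (toC t * e); rewrite subrK nte; lra.
have rho4 : normc rho <= 4^-1 by lra.
have cz : log_modulus n z @[n --> \oo] --> Re (phi z).
  exact: (nbhs_singleton log_modulus_cvg).
have ett : 0 < eta * t by rewrite mulr_gt0.
move/cvgrPdist_le : cvt => /(_ _ ett); move/cvgrPdist_le : cz => /(_ _ ett).
apply: filterS2 => n Hz Ht.
have Hinc := log_modulus_increment n rho4; rewrite -/rho in Hinc.
have sq : M * (5 * normc rho ^+ 2) <= eta * t.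
  have : normc rho ^+ 2 <= (2 * t) ^+ 2.
    by apply: lerXn2r; rewrite ?nnegrE ?normc_ge0// mulr_ge0// ltW.
  move=> /(ler_wpM2l M_ge0) r2.
  have : t * (20 * M + 1) <= eta by rewrite -ler_pdivlMr// ltW.
  move=> /(ler_wpM2r (ltW t0)); have := sqr_ge0 t.
  by rewrite !expr2 in r2 *; nra.
have Hg : `|Re (rho * g n) - Re (toC t * e * g n)| <= eta * t * M.
  rewrite -ReB -mulrBl (le_trans (le_Re_normc _))// Normc.normcM.
  by rewrite ler_pM// ?normc_ge0// normc_logder_le.
have Hp : `|Re (phi (z + toC t * e)) - Re (phi z) - Re (toC t * e * derive1 phi z)| <= eta * t.
  by rewrite -!ReB (le_trans (le_Re_normc _)).
have tE y : Re (toC t * e * y) = t * Re (e * y).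
  by rewrite -mulrA Re_toCM.
rewrite !tE in Hg Hp.
have : `|t * Re (e * derive1 phi z) - t * Re (e * g n)| <= t * eps.
  have : eta * t * (4 + M) <= t * eps by rewrite mulrAC mulrC ler_wpM2l// ltW.
  by move: Hg Hp Hinc Hz Ht; rewrite !ler_norml; lra.
by rewrite -mulrBr normrM gtr0_norm// ler_pM2l.
Unshelve. all: by end_near. Qed.

Lemma logder_cvg : g n @[n --> \oo] --> derive1 phi z.
Proof.
apply: cvgC_ReIm.
  have := Re_logder_cvg exp_direction1; rewrite mul1r.
  by under eq_fun do rewrite mul1r.
have iE y : Re ((Complex 0 1 : C) * y) = - Im y by rewrite ReM/= mul0r mul1r sub0r.
have := Re_logder_cvg exp_directioni; rewrite iE.
under eq_fun do rewrite iE.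
by move/cvgNP.
Qed.

End limit_of_logarithmic_derivatives.

End logarithmic_derivative.

(** * Stieltjes transforms outside the half-line *)

Section stieltjes_transform.
Context {R : realType}.
Local Notation C := (complexC R).
Local Notation Re := complex.Re.
Local Notation Im := complex.Im.
Local Notation normc := Normc.normc.
Implicit Types (mu : {finite_measure set R -> \bar R}) (f g : R -> C) (t : C).

Lemma bounded_measurableM (f g : R -> R) : bounded_measurable f -> bounded_measurable g ->
  bounded_measurable (fun x => f x * g x).
Proof.
move=> [mf [K fK]] [mg [L gL]]; split; first exact: measurable_funM.
by exists (K * L) => x x0; rewrite normrM ler_pM ?fK ?gL.
Qed.

Definition cbounded_measurable f :=
  bounded_measurable (fun x => Re (f x)) /\ bounded_measurable (fun x => Im (f x)).

Definition chalfline_integral mu f : C :=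
  Complex (halfline_integral mu (fun x => Re (f x)))
          (halfline_integral mu (fun x => Im (f x))).

Lemma cbounded_measurableM f g : cbounded_measurable f -> cbounded_measurable g ->
  cbounded_measurable (fun x => f x * g x).
Proof.
move=> [fr fi] [gr gi]; split.
  have := bounded_measurable_lin 1 (-1) (bounded_measurableM fr gr) (bounded_measurableM fi gi).
  by congr bounded_measurable; apply/funext => x; rewrite ReM mul1r mulN1r.
have := bounded_measurable_lin 1 1 (bounded_measurableM fr gi) (bounded_measurableM fi gr).
by congr bounded_measurable; apply/funext => x; rewrite ImM !mul1r.
Qed.

Lemma cbounded_measurable_cst (c : C) : cbounded_measurable (fun=> c).
Proof. by split; exact: bounded_measurable_cst. Qed.

Lemma cbounded_measurableD f g : cbounded_measurable f -> cbounded_measurable g ->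
  cbounded_measurable (fun x => f x + g x).
Proof.
move=> [fr fi] [gr gi]; split.
  have := bounded_measurable_lin 1 1 fr gr.
  by congr bounded_measurable; apply/funext => x; rewrite ReD !mul1r.
have := bounded_measurable_lin 1 1 fi gi.
by congr bounded_measurable; apply/funext => x; rewrite ImD !mul1r.
Qed.

Lemma chalfline_integralD mu f g : cbounded_measurable f -> cbounded_measurable g ->
  chalfline_integral mu (fun x => f x + g x) =
  chalfline_integral mu f + chalfline_integral mu g.
Proof.
move=> [fr fi] [gr gi]; apply: complexP; rewrite ?ReD ?ImD /=.
  rewrite -[X in X + _]mul1r -[X in _ + X]mul1r -halfline_integral_lin//.
  by apply: eq_halfline_integral => x _; rewrite ReD !mul1r.
rewrite -[X in X + _]mul1r -[X in _ + X]mul1r -halfline_integral_lin//.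
by apply: eq_halfline_integral => x _; rewrite ImD !mul1r.
Qed.

Lemma chalfline_integralZ mu (c : C) f : cbounded_measurable f ->
  chalfline_integral mu (fun x => c * f x) = c * chalfline_integral mu f.
Proof.
move=> [fr fi]; apply: complexP; rewrite ?ReM ?ImM /=.
  rewrite -mulNr -halfline_integral_lin//.
  by apply: eq_halfline_integral => x _; rewrite ReM mulNr.
rewrite -halfline_integral_lin//.
by apply: eq_halfline_integral => x _; rewrite ImM.
Qed.

(** The factor 2 comes from bounding the real and imaginary parts separately. *)
Lemma normc_chalfline_integral mu f (e : R) : cbounded_measurable f ->
  (forall x : R, 0 <= x -> normc (f x) <= e) ->
  normc (chalfline_integral mu f) <= 2 * e * halfline_mass mu.
Proof.
move=> [fr fi] fe; rewrite (le_trans (normc_le_ReIm _))//=.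
have b0 := @bounded_measurable_cst R 0.
have J0 : halfline_integral mu (fun=> 0) = 0.
  by rewrite /halfline_integral Rintegral_cst// mul0r.
have Hr : `|halfline_integral mu (fun x => Re (f x)) - halfline_integral mu (fun=> 0)|
    <= e * halfline_mass mu.
  apply: halfline_integral_dist => // x x0.
  by rewrite subr0 (le_trans (le_Re_normc _))// fe.
have Hi : `|halfline_integral mu (fun x => Im (f x)) - halfline_integral mu (fun=> 0)|
    <= e * halfline_mass mu.
  apply: halfline_integral_dist => // x x0.
  by rewrite subr0 (le_trans (le_Im_normc _))// fe.
by rewrite J0 !subr0 in Hr Hi; rewrite -mulrA mulr_natl mulr2n lerD.
Qed.

Lemma dist_nonneg_reals t : (~` nonneg_reals) t ->
  exists2 d : R, 0 < d & forall x : R, 0 <= x -> d <= normc (t - toC x).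
Proof.
move=> tN; have [t0|t0] := ltP (Re t) 0.
  exists (- Re t); first by rewrite oppr_gt0.
  move=> x x0; apply: le_trans (le_Re_normc _).
  by rewrite ReB Re_toC ler0_norm; lra.
exists `|Im t| => [|x x0]; last first.
  by apply: le_trans (le_Im_normc _); rewrite ImB Im_toC subr0.
rewrite normr_gt0; apply/eqP => ti; apply: tN; exists (Re t) => /=.
  by rewrite in_itv/= t0.
exact: complexP.
Qed.

Lemma open_nonneg_reals_compl t : (~` nonneg_reals) t ->
  \forall s \near t, (~` nonneg_reals) s.
Proof.
move=> /dist_nonneg_reals[d d0 H]; apply/nearC; exists d => // s st [x /=].
rewrite in_itv/= andbT => /H; rewrite normcB => + xs; rewrite xs.
by move=> /le_lt_trans/(_ st); rewrite ltxx.
Qed.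

(** With [y = s / (s + x)] one has [x = s / y - s], so [t - x = ((t + s) y - s) / y]. This puts the
    kernel in the form [g y * y] of [continuous_kernel_cvg]. *)
Lemma stieltjes_kernelE t (s x : R) : (~` nonneg_reals) t -> 0 < s -> 0 <= x ->
  (t - toC x)^-1 = toC (s / (s + x)) * ((t + toC s) * toC (s / (s + x)) - toC s)^-1.
Proof.
move=> tN s0 x0; have sx : s + x != 0 by rewrite gt_eqF// ltr_pwDl.
have [d d0 /(_ x x0) H] := dist_nonneg_reals tN.
have tx : t - toC x != 0 by rewrite -normc_gt0 (lt_le_trans d0).
have y0 : toC (s / (s + x)) != 0 :> C by rewrite fmorph_eq0 mulf_neq0 ?invr_eq0// gt_eqF.
have sC : toC s + toC x != 0 :> C by rewrite -rmorphD fmorph_eq0.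
have E : (t + toC s) * toC (s / (s + x)) - toC s = toC (s / (s + x)) * (t - toC x).
  by rewrite fmorph_div rmorphD/=; field.
by rewrite E invfM mulrA mulfV// mul1r.
Qed.

(** A zero with [y > 0] would force [t = s / y - s >= 0]; at [y = 0], the image of infinity, the
    value is [- s]. *)
Lemma stieltjes_denominator_neq0 t (s y : R) : (~` nonneg_reals) t -> 0 < s -> 0 <= y <= 1 ->
  (t + toC s) * toC y - toC s != 0.
Proof.
move=> tN s0 /andP[y0 y1]; apply/eqP => E.
have [yz|yn] := eqVneq y 0.
  have := congr1 (fun z : C => Re z) E; rewrite yz !complexE; lra.
have yp : 0 < y by rewrite lt_def yn.
apply: tN; exists (s / y - s) => /=.
  by rewrite in_itv/= andbT subr_ge0 ler_pdivlMr// ler_piMr// ltW.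
have yC : toC y != 0 :> C by rewrite fmorph_eq0.
rewrite rmorphB fmorph_div /=.
apply: (mulIf yC); rewrite mulrBl divfK//.
by move/eqP: E; rewrite subr_eq0 mulrDl => /eqP E; rewrite -[X in X - _]E addrK.
Qed.

Lemma continuous_Re_inv_affine (a b : C) (y : R) : a * toC y - b != 0 ->
  {for y, continuous (fun y : R => Re (a * toC y - b)^-1)} /\
  {for y, continuous (fun y : R => Im (a * toC y - b)^-1)}.
Proof.
move=> n0; have affC (c e : R) : {for y, continuous (fun y : R => c * y - e)}.
  by apply: cvgB; [apply: cvgM; [exact: cvg_cst|exact: cvg_id]|exact: cvg_cst].
have ReE (x : R) : Re (a * toC x - b) = Re a * x - Re b.
  by rewrite !complexE; ring.
have ImE (x : R) : Im (a * toC x - b) = Im a * x - Im b.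
  by rewrite !complexE; ring.
have d0 : (Re a * y - Re b) ^+ 2 + (Im a * y - Im b) ^+ 2 != 0.
  by rewrite -ReE -ImE -sqr_normc sqrf_eq0 normc_eq0.
have dC : {for y, continuous
    (fun y : R => ((Re a * y - Re b) ^+ 2 + (Im a * y - Im b) ^+ 2)^-1)}.
  by apply: cvgV => //; apply: cvgD; rewrite /= !expr2; apply: cvgM; exact: affC.
split.
  have -> : (fun y : R => Re (a * toC y - b)^-1) = (fun y : R => (Re a * y - Re b) *
      ((Re a * y - Re b) ^+ 2 + (Im a * y - Im b) ^+ 2)^-1).
    by apply/funext => x; rewrite ReV ReE ImE.
  by apply: cvgM => //; exact: affC.
have -> : (fun y : R => Im (a * toC y - b)^-1) = (fun y : R => - ((Im a * y - Im b) *
    ((Re a * y - Re b) ^+ 2 + (Im a * y - Im b) ^+ 2)^-1)).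
  by apply/funext => x; rewrite ImV ReE ImE.
by apply: cvgN; apply: cvgM => //; exact: affC.
Qed.

Lemma cbounded_measurable_stieltjes t : (~` nonneg_reals) t ->
  cbounded_measurable (fun x => (t - toC x)^-1).
Proof.
move=> tN; have [d d0 H] := dist_nonneg_reals tN.
have n0 (x : R) : 0 <= x -> -1 * toC x - (- t) != 0.
  by move=> /H; rewrite mulN1r opprK addrC => dx; rewrite -normc_gt0 (lt_le_trans d0).
have E (x : R) : (t - toC x)^-1 = (-1 * toC x - (- t))^-1.
  by rewrite mulN1r opprK addrC.
have FR : (fun x : R => Re (t - toC x)^-1) = (fun x : R => Re (-1 * toC x - (- t))^-1).
  by apply/funext => x; rewrite E.
have FI : (fun x : R => Im (t - toC x)^-1) = (fun x : R => Im (-1 * toC x - (- t))^-1).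
  by apply/funext => x; rewrite E.
have nE (x : R) : 0 <= x -> normc (t - toC x)^-1 <= d^-1.
  by move=> /H dx; rewrite Normc.normcV lef_pV2// posrE (lt_le_trans d0).
split; split.
- apply: continuous_halfline_measurable => x /n0/continuous_Re_inv_affine[+ _].
  by rewrite FR.
- by exists d^-1 => x /nE; apply: le_trans; exact: le_Re_normc.
- apply: continuous_halfline_measurable => x /n0/continuous_Re_inv_affine[_ +].
  by rewrite FI.
- by exists d^-1 => x /nE; apply: le_trans; exact: le_Im_normc.
Qed.

(** No differentiation theorem under the integral is invoked: the remainder of the difference
    quotient of the kernel is exactly [h / ((t + h - x) (t - x)^2)], which is uniformly small in
    [x]. *)
Lemma stieltjes_derivable mu t : (~` nonneg_reals) t -> derivable (stieltjes mu) t 1.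
Proof.
move=> tN; have [d d0 H] := dist_nonneg_reals tN.
pose k s (x : R) := (s - toC x)^-1 : C.
pose S' := chalfline_integral mu (fun x => - (1 : C) * (k t x * k t x)).
apply/cvg_ex; exists S'; apply/cvgC_normc/cvgr0Pnorm_le => e e0.
(* For [|h| < d / 2] the point [t + h] stays at distance [d / 2] from the half-line, so the
   remainder is at most [|h| * 2 / d^3]; the added 1 makes [K] positive even for the zero
   measure. *)
pose K := 2 * (2 / d ^+ 3) * halfline_mass mu + 1.
have K0 : 0 < K.
  rewrite ltr_wpDl// !mulr_ge0 ?halfline_mass_ge0//.
  by rewrite invr_ge0 exprn_ge0// ltW.
rewrite near_withinE; apply/nearC; exists (Num.min (d / 2) (e / K)).
  by rewrite lt_min !divr_gt0.
move=> h; rewrite subr0 lt_min => /andP[hd he] h0.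
rewrite ger0_norm ?normc_ge0//.
have thx (x : R) : 0 <= x -> d / 2 <= normc (t + h - toC x).
  move=> /H dx; have := normcD (t + h - toC x) (- h).
  by rewrite normcN (_ : _ - h = t - toC x); [lra|ring].
have thN : (~` nonneg_reals) (t + h).
  move=> [x /=]; rewrite in_itv/= andbT => /thx + xE; rewrite -xE subrr Normc.normc0; lra.
have bt := cbounded_measurable_stieltjes tN.
have bth := cbounded_measurable_stieltjes thN.
have bN c g (bg : cbounded_measurable g) := cbounded_measurableM (cbounded_measurable_cst c) bg.
pose r (x : R) := h^-1 * k (t + h) x + (- h^-1 * k t x + 1 * (k t x * k t x)).
have br : cbounded_measurable r.
  apply: cbounded_measurableD; first exact: bN.
  apply: cbounded_measurableD; apply: bN => //; exact: cbounded_measurableM.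
have -> : h^-1 *: (stieltjes mu (h *: 1 + t) - stieltjes mu t) - S' = chalfline_integral mu r.
  rewrite /r chalfline_integralD; [|exact: bN|]; last first.
    by apply: cbounded_measurableD; apply: bN => //; exact: cbounded_measurableM.
  rewrite chalfline_integralD; [|exact: bN|by apply: bN; exact: cbounded_measurableM].
  rewrite /S' !chalfline_integralZ//; [|exact: cbounded_measurableM|exact: cbounded_measurableM].
  rewrite -[_ *: (1 : C)]/(h * 1) mulr1 [h + t]addrC.
  rewrite -[stieltjes mu (t + h)]/(chalfline_integral mu (k (t + h))).
  rewrite -[stieltjes mu t]/(chalfline_integral mu (k t)).
  rewrite -[_ *: _]/(_ * _); ring.
have rE (x : R) : 0 <= x -> normc (r x) <= normc h * (2 / d ^+ 3).
  move=> x0; have tx := H x x0; have txh := thx x x0.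
  have d2 : 0 < d / 2 by rewrite divr_gt0.
  have n1 : t - toC x != 0 by rewrite -normc_gt0 (lt_le_trans d0).
  have n2 : t + h - toC x != 0 by rewrite -normc_gt0 (lt_le_trans d2).
  have -> : r x = h * ((t + h - toC x)^-1 * ((t - toC x)^-1 * (t - toC x)^-1)).
    by rewrite /r /k; field; rewrite h0 n1 n2.
  rewrite !Normc.normcM !Normc.normcV ler_wpM2l ?normc_ge0//.
  have -> : 2 / d ^+ 3 = (d / 2)^-1 * (d^-1 * d^-1) by field; rewrite gt_eqF.
  have i1 : (normc (t - toC x))^-1 <= d^-1 by rewrite lef_pV2// posrE (lt_le_trans d0).
  have i2 : (normc (t + h - toC x))^-1 <= (d / 2)^-1 by rewrite lef_pV2// posrE (lt_le_trans d2).
  by rewrite !ler_pM ?mulr_ge0 ?invr_ge0 ?normc_ge0.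
apply: (le_trans (normc_chalfline_integral mu br rE)).
have : normc h * K <= e by rewrite -ler_pdivlMr// ltW.
by apply: le_trans; rewrite /K; have := normc_ge0 h; lra.
Qed.

Lemma stieltjes_cvg (nu : nat -> {finite_measure set R -> \bar R})
    (Z : {finite_measure set R -> \bar R}) (M a b : R) :
  (forall n, halfline_mass (nu n) <= M) -> halfline_mass Z <= M ->
  0 < a -> a < b ->
  (forall s : R, a < s -> s < b -> integral_cvg nu Z (fun x => (s + x)^-1)) ->
  forall t, (~` nonneg_reals) t -> stieltjes (nu n) t @[n --> \oo] --> stieltjes Z t.
Proof.
move=> nuM ZM a0 ab kcvg t tN.
pose s := (a + b) / 2.
have sa : a < s by rewrite /s; lra.
have sb : s < b by rewrite /s; lra.
have s0 := lt_trans a0 sa.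
have [br bi] := cbounded_measurable_stieltjes tN.
have cont (y : R) : 0 <= y <= 1 ->
    {for y, continuous (fun y : R => Re ((t + toC s) * toC y - toC s)^-1)} /\
    {for y, continuous (fun y : R => Im ((t + toC s) * toC y - toC s)^-1)}.
  by move=> y01; apply: continuous_Re_inv_affine; exact: stieltjes_denominator_neq0.
apply: cvgC_ReIm => /=.
  have [] := @continuous_kernel_cvg R nu Z M nuM ZM a b a0 kcvg
    (fun y : R => Re ((t + toC s) * toC y - toC s)^-1) _ s sa sb br => //.
    by move=> y /cont[].
  by move=> x x0; rewrite (stieltjes_kernelE tN s0 x0) ReM Re_toC Im_toC mul0r subr0 mulrC.
have [] := @continuous_kernel_cvg R nu Z M nuM ZM a b a0 kcvg
  (fun y : R => Im ((t + toC s) * toC y - toC s)^-1) _ s sa sb bi => //.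
  by move=> y /cont[].
by move=> x x0; rewrite (stieltjes_kernelE tN s0 x0) ImM Re_toC Im_toC mul0r addr0 mulrC.
Qed.

End stieltjes_transform.

(** * Vague convergence from convergence on kernels *)

Section vague_convergence.
Context {R : realType}.

Lemma compactly_supported_bounded (f : R -> R) : compactly_supported f ->
  exists2 B : R, 0 < B & forall x, f x != 0 -> `|x| <= B.
Proof.
move=> /compact_bounded[M [_ MB]]; exists (`|M| + 1) => [|x fx].
  by rewrite ltr_wpDl.
apply: (MB (`|M| + 1)); last exact: subset_closure.
by rewrite (le_lt_trans (ler_norm _))// ltrDl.
Qed.

Lemma continuous_compactly_supported_bounded (f : R -> R) : continuous f ->
  compactly_supported f -> exists K : R, forall x, `|f x| <= K.
Proof.
move=> cf sf; have cK : compact (f @` closure [set x | f x != 0]).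
  by apply: continuous_compact => //; exact: continuous_subspaceT.
have [M [_ MB]] := compact_bounded cK; exists (`|M| + 1) => x.
have [->|fx] := eqVneq (f x) 0; first by rewrite normr0 addr_ge0.
apply: (MB (`|M| + 1)); first by rewrite (le_lt_trans (ler_norm _))// ltrDl.
by exists x => //; exact: subset_closure.
Qed.

Lemma Rintegral_supported_on_nonneg (mu : {finite_measure set R -> \bar R}) (f : R -> R) :
  supported_on_nonneg mu -> continuous f -> (exists K : R, forall x, `|f x| <= K) ->
  \int[mu]_x f x = halfline_integral mu f.
Proof.
move=> mu0 cf [K fK].
have fint : mu.-integrable setT (EFin \o f).
  apply: measurable_bounded_integrable => //.
  - by rewrite ltey_eq fin_num_measure.
  - exact: continuous_measurable_fun.
  - exists K; split; first exact: num_real.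
    by move=> L KL x _ /=; rewrite (le_trans (fK x))// ltW.
rewrite /halfline_integral /Rintegral (@negligible_integral _ _ _ mu setT `]-oo, 0[%classic)//.
congr (fine (integral _ _ _)).
by rewrite setTD -setCitvr setCK.
Qed.

Lemma kernel_vague_cvg (nu : nat -> {finite_measure set R -> \bar R})
    (Z : {finite_measure set R -> \bar R}) (M a b : R) :
  (forall n, supported_on_nonneg (nu n)) -> supported_on_nonneg Z ->
  (forall n, halfline_mass (nu n) <= M) -> halfline_mass Z <= M ->
  0 < a -> a < b ->
  (forall s : R, a < s -> s < b -> integral_cvg nu Z (fun x => (s + x)^-1)) ->
  vague_cvg nu Z.
Proof.
move=> nu0 Z0 nuM ZM a0 ab kcvg f cf sf.
have fb := continuous_compactly_supported_bounded cf sf.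
have [B B0 fB] := compactly_supported_bounded sf.
rewrite Rintegral_supported_on_nonneg//.
under eq_fun do rewrite Rintegral_supported_on_nonneg//.
pose s := (a + b) / 2.
have sa : a < s by rewrite /s; lra.
have sb : s < b by rewrite /s; lra.
have s0 := lt_trans a0 sa.
have bf : bounded_measurable f.
  split; first by apply: continuous_halfline_measurable => x _; exact: cf.
  by have [K fK] := fb; exists K => x _.
(* The inverse substitution [x = s / y - s] carries infinity to [y = 0]; compact support of [f]
   makes [g] vanish near 0, so the division by [y] does not spoil continuity. *)
pose g (y : R) := if y <= 0 then 0 else f (s / y - s) / y.
have [] // := @continuous_kernel_cvg R nu Z M nuM ZM a b a0 kcvg g f s sa sb bf.
  move=> y /andP[]; rewrite le_eqVlt => /predU1P[<- _|y0 _].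
    have near0 : \forall t \near (0 : R), g t = 0.
      (* Below this threshold [s / t - s > B + 1], which is outside the support of [f]. *)
      have d0 : 0 < s / (B + s + 1) by rewrite divr_gt0// !addr_gt0.
      near=> t; rewrite /g; case: ifPn => //; rewrite -ltNge => t0.
      have td : t < s / (B + s + 1) by near: t; exact: lt_nbhsl.
      have [->|ft] := eqVneq (f (s / t - s)) 0; first by rewrite mul0r.
      have := fB _ ft; have : B + s + 1 < s / t.
        by rewrite ltr_pdivlMr// mulrC -ltr_pdivlMr// !addr_gt0.
      by move=> H; rewrite ler_norml; lra.
    have g0 : g 0 = 0 by rewrite /g lexx.
    apply/cvgrPdist_lt => e e0; rewrite g0.
    by apply: filterS near0 => t ->; rewrite subrr normr0.
  have neary : {near y, (fun t : R => f (s / t - s) / t) =1 g}.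
    near=> t; rewrite /g leNgt.
    have -> // : 0 < t by near: t; exact: lt_nbhsr.
  apply: cvg_trans (near_eq_cvg neary) _.
  have -> : g y = f (s / y - s) / y by rewrite /g leNgt y0.
  have yV : t^-1 @[t --> y] --> y^-1 by apply: cvgV; [rewrite gt_eqF|exact: cvg_id].
  apply: cvgM => //; apply: continuous_cvg; first exact: cf.
  by apply: cvgB; [apply: cvgM => //; exact: cvg_cst|exact: cvg_cst].
move=> x x0; have sx : 0 < s + x by rewrite ltr_pwDl.
rewrite /g leNgt divr_gt0//= divfK; last by rewrite gt_eqF// divr_gt0.
by congr f; field; rewrite !gt_eqF.
Unshelve. all: by end_near. Qed.

End vague_convergence.

(** * Application to mod-phi convergence and identification of the limit *)

Section mod_phi_zeros.
Context {R : realType}.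
Local Notation C := (complexC R).
Local Notation Re := complex.Re.
Local Notation Im := complex.Im.
Local Notation normc := Normc.normc.

Lemma ereal_itv_segment (bm bp : \bar R) : (bm < bp)%E ->
  exists y1 y2 : R, y1 < y2 /\ forall y, y1 <= y -> y <= y2 -> ereal_itv bm bp y.
Proof.
case: bm bp => [r| |] [r'| |] //.
- rewrite lte_fin => rr; exists ((2 * r + r') / 3), ((r + 2 * r') / 3).
  by split=> [|y y1 y2]; [|split; rewrite lte_fin]; lra.
- by move=> _; exists (r + 1), (r + 2); split=> [|y y1 y2]; [|split; rewrite ?lte_fin ?ltry]; lra.
- by move=> _; exists (r' - 2), (r' - 1); split=> [|y y1 y2]; [|split; rewrite ?lte_fin ?ltNyr]; lra.
- by move=> _; exists 0, 1; split=> [|y y1 y2]; [|split; rewrite ?ltry ?ltNyr].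
Qed.

Variables (d : nat -> measure_display) (T : forall n, measurableType (d n))
    (P : forall n, probability (T n) R) (X : forall n, {RV (P n) >-> R})
    (G : nat -> {poly R})
    (bm bp : \bar R) (w : nat -> {posnum R}) (D : set C)
    (phi Psi : C -> C).
Hypothesis X_nat : forall n o, X n o \is a Num.nat.
Hypothesis X_bounded : forall n, exists M : R, {ae P n, forall o, X n o <= M}.
Hypothesis G_pgf : forall n (t : R),
      ('E_(P n)[(fun o => t ^+ Num.truncn (X n o))%R])%E = ((G n).[t])%:E.
Hypothesis G_real_zeros : forall n, only_real_zeros (G n).
Hypothesis X_mod_phi : mod_phi_cvg X bm bp w D phi Psi.
Variable M : R.
Hypothesis deg_bound : forall n, ((size (G n)).-1)%:R / (w n)%:num <= M.

Let rts n : seq R := [seq - Re r | r <- complex_zeros (G n)].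
Let nu n : {finite_measure set R -> \bar R} := zeros_measure (w n) (G n).

Let G_neq0 n : G n != 0.
Proof.
apply/eqP => G0; have := pgf_gt0 (@X_nat n) (X_bounded n) (G_pgf n) ltr01.
by rewrite G0 horner0 ltxx.
Qed.

Let G_zeros n : nonpositive_zeros (G n).
Proof.
by move=> r /(pgf_zerosE (@X_nat n) (X_bounded n) (G_pgf n) (@G_real_zeros n))[].
Qed.

Lemma zeros_measure_mass n : halfline_mass (nu n) <= M.
Proof. by rewrite halfline_mass_zeros. Qed.

(** [Psi z != 0] keeps the logarithm of the limit finite and the last condition makes the ratios
    bounded. All three are open and hold at the real points of the strip. *)
Definition regular_point (z : C) := [/\ D z, Psi z != 0 & 0 < Re (cexp z)].

Lemma derivableC_cvg (f : C -> C) z : derivable f z 1 -> f y @[y --> z] --> f z.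
Proof. by move=> /derivable1_diffP/differentiable_continuous. Qed.

Lemma regular_point_near z : regular_point z -> \forall y \near z, regular_point y.
Proof.
case=> Dz Pz ez.
have nD : \forall y \near z, D y.
  by apply: open_nbhs_nbhs; split=> //; exact: mod_phi_open X_mod_phi.
have nP : \forall y \near z, Psi y != 0.
  have H := @cvgC_normcl R C (nbhs z) (nbhs_filter z) Psi (Psi z)
    (derivableC_cvg (mod_phi_limit_analytic X_mod_phi Dz)).
  rewrite -normc_gt0 in Pz.
  have H2 : \forall y \near z, 0 < normc (Psi y) by exact: (cvgr_gt _ H _ Pz).
  by apply: filterS H2 => y; rewrite normc_gt0.
have nE : \forall y \near z, 0 < Re (cexp y).
  have rE (y : C) : Re (cexp y) = expR (Re y) * cos (Im y) by [].
  have cos0 : 0 < cos (Im z) by move: ez; rewrite rE pmulr_rgt0 ?expR_gt0.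
  have cI : cos (Im y) @[y --> z] --> cos (Im z).
    have cIm : Im (y : C) @[y --> z] --> Im z :=
      @cvgC_Im _ _ (nbhs z) (nbhs_filter z) id z (@cvg_id _ _).
    exact: (cvg_comp _ _ cIm (@continuous_cos R (Im z))).
  have H : \forall y \near z, 0 < cos (Im y) by exact: (cvgr_gt _ cI _ cos0).
  apply: filterS H => y cy.
  by rewrite rE mulr_gt0 ?expR_gt0.
by near=> y; split; near: y.
Unshelve. all: by end_near. Qed.

Lemma regular_point_real y : ereal_itv bm bp y -> regular_point (toC y).
Proof.
move=> /(mod_phi_itv X_mod_phi) Dy; split=> //.
  exact: mod_phi_limit_neq0 X_mod_phi _ Dy.
by rewrite /= cos0 mulr1 expR_gt0.
Qed.

Lemma normc_laplace_cvg z : D z ->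
  `|lead_coef (G n)| * \prod_(x <- rts n) normc (cexp z + toC x) /
    expR ((w n)%:num * Re (phi z)) @[n --> \oo] --> normc (Psi z).
Proof.
move=> Dz; have /(_ [set z] (@compact_set1 _ z)) := mod_phi_limit X_mod_phi.
rewrite uniform_set1 => /(_ _)/cvgC_normcl H.
have {}H := H _; apply: cvg_trans (H _) => [|y ->//].
apply: near_eq_cvg; apply: nearW => n.
transitivity (normc (laplace (X n) z) * normc (cexp (toC (w n)%:num * phi z))^-1).
  exact: Normc.normcM.
rewrite Normc.normcV normc_cexp Re_toCM.
rewrite (normc_laplace (@X_nat n) (X_bounded n) (G_pgf n) (@G_real_zeros n)).
by rewrite /rts big_map.
Qed.

Lemma stieltjes_zeros n s : (~` nonneg_reals) s ->
  stieltjes (nu n) s = toC (w n)%:num^-1 * \sum_(x <- rts n) (s - toC x)^-1.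
Proof.
move=> /cbounded_measurable_stieltjes[br bi].
apply: complexP; rewrite ?ReM ?ImM sum_complexE Re_toC Im_toC mul0r ?subr0 ?addr0 /=.
  by rewrite [LHS](halfline_integral_zeros (w n) (@G_zeros n) br) /rts big_map.
by rewrite [LHS](halfline_integral_zeros (w n) (@G_zeros n) bi) /rts big_map.
Qed.

Lemma opp_cexp_nonneg z : 0 < Re (cexp z) -> (~` (@nonneg_reals R)) (- cexp z).
Proof.
move=> ez [x]; rewrite /= in_itv/= andbT => x0 /(congr1 (fun z : C => Re z)).
by rewrite ReN Re_toC; lra.
Qed.

Lemma stieltjes_zeros_cvg z : regular_point z ->
  stieltjes (nu n) (- cexp z) @[n --> \oo] --> derive1 phi z / (- cexp z).
Proof.
move=> rz; case: (rz) => Dz Pz ez.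
have wR n : 0 < (w n)%:num by [].
have cR n : 0 < `|lead_coef (G n)| by rewrite normr_gt0 lead_coef_eq0.
have r0 n x : x \in rts n -> 0 <= x.
  by move=> /mapP[r /G_zeros rn ->]; rewrite oppr_ge0.
have rsz n : (size (rts n))%:R <= M * (w n)%:num.
  by rewrite size_map size_complex_zeros// -ler_pdivrMr.
have mc : \forall y \near z, 0 < normc (Psi y) /\
    `|lead_coef (G n)| * \prod_(x <- rts n) normc (cexp y + toC x) /
    expR ((w n)%:num * Re (phi y)) @[n --> \oo] --> normc (Psi y).
  apply: filterS (regular_point_near rz) => y [Dy Py _].
  by split; [rewrite normc_gt0|exact: normc_laplace_cvg].
have := logder_cvg wR (mod_phi_w X_mod_phi) cR r0 rsz (mod_phi_analytic X_mod_phi Dz) ez mc.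
have e0 := cexp_neq0 z.
move=> H; rewrite invrN mulrN -mulNr mulrC.
have -> : (fun n => stieltjes (nu n) (- cexp z)) = (fun n => (cexp z)^-1 *
    - (toC (w n)%:num^-1 * \sum_(x <- rts n) cexp z / (cexp z + toC x))).
  apply/funext => n; rewrite stieltjes_zeros; last exact: opp_cexp_nonneg.
  rewrite mulrN mulrCA -mulrN; congr (_ * _).
  rewrite mulr_sumr -sumrN; apply: eq_bigr => x _.
  by rewrite mulrA mulVf// mul1r -opprD invrN.
by apply: cvgM; [exact: cvg_cst|exact: cvgN].
Qed.

(** A real segment of the strip corresponds under [expR] to an interval of parameters [s], where
    mod-phi convergence gives a limit along the whole sequence. The ultrafilter refines [\oo], so
    this limit is the integral against [Z]. *)
Lemma zeros_limit_measure : exists (Z : {finite_measure set R -> \bar R}) (a b : R),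
  [/\ supported_on_nonneg Z, halfline_mass Z <= M, 0 < a, a < b &
    forall s : R, a < s -> s < b -> integral_cvg nu Z (fun x => (s + x)^-1)].
Proof.
have [Z [U [PU ooU Z0 ZM ZU]]] := helly_kernel zeros_measure_mass.
have [y1 [y2 [y12 yI]]] := ereal_itv_segment (mod_phi_lt X_mod_phi).
exists Z, (expR y1), (expR y2); split; rewrite ?expR_gt0 ?ltr_expR// => s s1 s2.
have s0 : 0 < s by rewrite (lt_trans _ s1)// expR_gt0.
have sE : expR (ln s) = s by rewrite lnK.
have rs : regular_point (toC (ln s)).
  by apply/regular_point_real/yI; rewrite -ler_expR sE ltW.
split; first by have := bounded_measurable_kernel 1 s0.
have cE : - cexp (toC (ln s)) = toC (- s) :> C.
  by apply: complexP; rewrite /= ?sE ?cos0 ?sin0 ?mulr1 ?mulr0 ?oppr0.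
have H := cvgC_Re (stieltjes_zeros_cvg rs).
rewrite cE in H.
have sN mu : Re (stieltjes mu (toC (- s))) = - halfline_integral mu (fun x => (s + x)^-1).
  have bk : bounded_measurable (fun x : R => (s + x)^-1).
    by have := bounded_measurable_kernel 1 s0.
  rewrite -[RHS]mulN1r -[RHS]addr0.
  rewrite -[X in _ + X](mul0r (halfline_integral mu (fun x => (s + x)^-1))).
  rewrite -halfline_integral_lin//; apply: eq_halfline_integral => x x0.
  by rewrite -rmorphB -fmorphV Re_toC mul0r addr0 mulN1r -opprD invrN.
have {}H : halfline_integral (nu n) (fun x => (s + x)^-1) @[n --> \oo] -->
    - Re (derive1 phi (toC (ln s)) / toC (- s)).
  apply/cvgNP; rewrite opprK; apply: cvg_trans (H _); apply: near_eq_cvg.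
  by apply: nearW => n; exact: sN.
suff -> : halfline_integral Z (fun x => (s + x)^-1) =
    - Re (derive1 phi (toC (ln s)) / toC (- s)) by [].
apply: (cvg_unique _ (ZU s s0)) => //.
by apply: cvg_trans H => A /ooU.
Qed.

Lemma zeros_measures_vague_limit :
  (forall n, supported_on_nonneg (nu n)) /\
  exists Z : {finite_measure set R -> \bar R},
    [/\ supported_on_nonneg Z,
        vague_cvg nu Z &
        exists F : C -> C,
          [/\ analytic_on (~` nonneg_reals) F,
              (forall t : R, t < 0 -> ereal_itv bm bp (ln (- t)) ->
                \forall s \near toC t,
                  D (clog (- s)) /\ F s = derive1 phi (clog (- s)) / s) &
              forall t, (~` nonneg_reals) t -> stieltjes Z t = F t]].
Proof.
have nu0 n : supported_on_nonneg (nu n) by apply: zeros_measure_neg.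
split=> //; have [Z [a [b [Z0 ZM a0 ab kc]]]] := zeros_limit_measure.
exists Z; split=> //; first exact: (kernel_vague_cvg nu0 Z0 zeros_measure_mass ZM a0 ab kc).
(* Taking the transform itself as continuation leaves only the local formula: near [t], both
   [stieltjes Z s] and [derive1 phi (clog (- s)) / s] are limits of [stieltjes (nu n) s]. *)
exists (stieltjes Z); split=> // [t|t t0 tI]; first exact: stieltjes_derivable.
have nt0 : 0 < - t by rewrite oppr_gt0.
have cl : clog (- s) @[s --> (toC t : C)] --> (toC (ln (- t)) : C).
  apply: (@cvg_clog R C (nbhs (toC t : C)) (nbhs_filter _) (fun s => - s) (- t) nt0).
  by rewrite rmorphN; apply: cvgN; exact: cvg_id.
have nr : \forall s \near (toC t : C), regular_point (clog (- s)).
  exact: cl (regular_point_near (regular_point_real tI)).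
have nN : \forall s \near (toC t : C), (~` nonneg_reals) s.
  apply: open_nonneg_reals_compl => -[x]; rewrite /= in_itv/= andbT => x0 [xt].
  by move: t0; rewrite -xt ltNge x0.
near=> s.
have rs : regular_point (clog (- s)) by near: s.
have sN : (~` nonneg_reals) s by near: s.
split; first by case: rs.
have s0 : s != 0.
  by apply/eqP => s0; apply: sN; exists 0 => //=; rewrite in_itv/= lexx.
have := stieltjes_zeros_cvg rs; rewrite cexp_clog ?oppr_eq0// opprK => H.
exact: cvgC_unique (stieltjes_cvg zeros_measure_mass ZM a0 ab kc sN) H.
Unshelve. all: by end_near. Qed.

End mod_phi_zeros.

Theorem proposition2p14 (R : realType)
    (d : nat -> measure_display) (T : forall n, measurableType (d n))
    (P : forall n, probability (T n) R) (X : forall n, {RV (P n) >-> R})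
    (G : nat -> {poly R})
    (bm bp : \bar R) (w : nat -> {posnum R}) (D : set (complexC R))
    (phi Psi : complexC R -> complexC R)
    (X_nat : forall n o, X n o \is a Num.nat)
    (X_bounded : forall n, exists M : R, {ae P n, forall o, X n o <= M})
    (G_pgf : forall n (t : R),
      ('E_(P n)[(fun o => t ^+ Num.truncn (X n o))%R])%E = ((G n).[t])%:E)
    (G_real_zeros : forall n, only_real_zeros (G n))
    (X_mod_phi : mod_phi_cvg X bm bp w D phi Psi)
    (deg_bound : has_ubound (range (fun n : nat =>
      ((size (G n)).-1)%:R / (w n)%:num : R))) :
  (forall n, supported_on_nonneg (zeros_measure (w n) (G n))) /\
  exists Z : {finite_measure set R -> \bar R},
    [/\ supported_on_nonneg Z,
        vague_cvg (fun n => zeros_measure (w n) (G n)) Z &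
        exists F : complexC R -> complexC R,
          [/\ analytic_on (~` nonneg_reals) F,
              (forall t : R, t < 0 -> ereal_itv bm bp (ln (- t)) ->
                \forall s \near toC t,
                  D (clog (- s)) /\ F s = derive1 phi (clog (- s)) / s) &
              forall t, (~` nonneg_reals) t -> stieltjes Z t = F t]].
Proof.
have [M degM] := deg_bound.
apply: (zeros_measures_vague_limit X_nat X_bounded G_pgf G_real_zeros X_mod_phi (M := M)).
by move=> n; apply: degM; exists n.
Qed.
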